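(* Let $(A,\alpha,\mathbb{Z}_+^2)$ be a C*-dynamical system and let $(\pi,T)$ be a contractive covariant pair of $(A,\alpha,\mathbb{Z}_+^2)$ on a Hilbert space $H$. Then $(\pi,T)$ co-extends to an isometric covariant pair $(\sigma,V)$ of $(A,\alpha,\mathbb{Z}_+^2)$. Hence $$A\times_\alpha\mathbb{Z}_+^2\simeq A\times_\alpha^{\mathrm{is}}\mathbb{Z}_+^2 .$$
   Context: A C*-dynamical system $(A,\alpha,\mathbb{Z}_+^2)$ is a semigroup homomorphism $\alpha$ from $\mathbb{Z}_+^2$ to the $*$-endomorphisms of a C*-algebra $A$ (no injectivity, unitality or non-degeneracy assumed). A contractive (isometric) covariant pair is $(\pi,T)$ with $\pi\colon A\to\mathcal{B}(H)$ a $*$-representation, $T\colon\mathbb{Z}_+^2\to\mathcal{B}(H)$ a unital semigroup homomorphism into contractions (isometries), and $\pi(a)T_s=T_s\pi(\alpha_s(a))$ for all $a\in A$, $s\in\mathbb{Z}_+^2$. The pair $(\sigma,V)$ on $K\supseteq H$ co-extends $(\pi,T)$ if $H$ is reducing for $\sigma$ with $\sigma(\cdot)|_H=\pi$, and $H$ is invariant for each $V_s^*$ with $V_s^*|_H=T_s^*$. Let $c_{00}(\mathbb{Z}_+^2,\alpha,A)$ be the algebra of finitely supported $A$-valued functions on $\mathbb{Z}_+^2$ with product $(e_s\otimes a)(e_t\otimes b)=e_{s+t}\otimes\alpha_t(a)b$, and $(T\times\pi)(e_s\otimes a)=T_s\pi(a)$. $A\times_\alpha\mathbb{Z}_+^2$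 (respectively $A\times_\alpha^{\mathrm{is}}\mathbb{Z}_+^2$) is the operator algebra completion of $c_{00}(\mathbb{Z}_+^2,\alpha,A)$ for the matrix norms given by the supremum of $\|(T\times\pi)^{(n)}(\cdot)\|$ over all contractive (respectively isometric) covariant pairs. $\simeq$ means (canonically) completely isometrically isomorphic. *)

(* Defs.v *)
From HB Require Import structures.
From mathcomp Require Import all_boot all_order all_algebra finmap complex.
From mathcomp Require Import all_classical all_reals all_analysis.

Set Implicit Arguments.
Unset Strict Implicit.
Unset Printing Implicit Defensive.

Import Order.TTheory GRing.Theory Num.Theory.
Import numFieldNormedType.Exports.

Local Open Scope classical_set_scope.
Local Open Scope ring_scope.
Local Open Scope complex_scope.

(* The product is a plain operation because C*-algebras need not be unital
   whereas the library's rings are. *)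
HB.mixin Record isCStarAlgebra (R : realType) A
    of CompleteNormedModule R[i] A := {
  cmul : A -> A -> A;
  cstar : A -> A;
  cmulA : associative cmul;
  cmulDl : left_distributive cmul +%R;
  cmulDr : right_distributive cmul +%R;
  cmulZl : forall (c : R[i]) (a b : A), cmul (c *: a) b = c *: cmul a b;
  cmulZr : forall (c : R[i]) (a b : A), cmul a (c *: b) = c *: cmul a b;
  cstarK : involutive cstar;
  cstarD : {morph cstar : a b / a + b};
  cstarZ : forall (c : R[i]) (a : A), cstar (c *: a) = Num.conj c *: cstar a;
  cstarM : forall a b : A, cstar (cmul a b) = cmul (cstar b) (cstar a);
  cnormM : forall a b : A, `|cmul a b| <= `|a| * `|b|;
  cnorm_star : forall a : A, `|cmul (cstar a) a| = `|a| ^+ 2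
}.

#[short(type="cstarAlgType")]
HB.structure Definition CStarAlgebra (R : realType) :=
  {A of isCStarAlgebra R A & CompleteNormedModule R[i] A}.

(* The inner product is linear in its first argument. *)
HB.mixin Record isHilbert (R : realType) H of CompleteNormedModule R[i] H := {
  inner : {dot H for Num.conj};
  norm_inner : forall x : H, `|x| ^+ 2 = inner x x
}.

#[short(type="hilbertType")]
HB.structure Definition Hilbert (R : realType) :=
  {H of isHilbert R H & CompleteNormedModule R[i] H}.

Section Operators.
Variables (R : realType) (H : hilbertType R).

Definition bounded_op (S : H -> H) : Prop :=
  linear S /\ exists M : R[i], forall x, `|S x| <= M * `|x|.

Definition is_adjoint (S S' : H -> H) : Prop :=
  forall x y, inner (S x) y = inner x (S' y).

Definition orthocompl (M : set H) : set H :=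
  [set y | forall x, M x -> inner x y = 0].

Definition reducing (S : H -> H) (M : set H) : Prop :=
  S @` M `<=` M /\ S @` orthocompl M `<=` orthocompl M.

(* Norms take values in R[i]; this is the same norm as a real number. *)
Definition rnorm (x : H) : R := complex.Re `|x|.

Definition l2norm n (x : 'I_n -> H) : R :=
  Num.sqrt (\sum_(j < n) rnorm (x j) ^+ 2).

(* The norm of an operator matrix acting on the Hilbert space H^n. *)
Definition mx_opnorm n (F : 'I_n -> 'I_n -> H -> H) : \bar R :=
  ereal_sup [set (l2norm (fun i => \sum_(j < n) F i j (x j)))%:E
            | x in [set x : 'I_n -> H | l2norm x <= 1]].

End Operators.

Section DynamicalSystems.
Variables (R : realType) (A : cstarAlgType R).

Definition star_endomorphism (f : A -> A) : Prop :=
  [/\ linear f, {morph f : a b / cmul a b} & {morph f : a / cstar a}].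

(* As alpha is only a semigroup homomorphism, alpha 0 is an idempotent and is
   not required to be the identity. *)
Record cstar_dyn := CStarDyn {
  dyn_act :> nat * nat -> A -> A;
  dyn_endo : forall s, star_endomorphism (dyn_act s);
  dyn_actD : forall s t a, dyn_act (s + t) a = dyn_act s (dyn_act t a)
}.

Definition star_representation (H : hilbertType R) (pi : A -> H -> H) : Prop :=
  [/\ forall a, bounded_op (pi a),
      forall (c : R[i]) a b h, pi (c *: a + b) h = c *: pi a h + pi b h,
      forall a b h, pi (cmul a b) h = pi a (pi b h) &
      forall a, is_adjoint (pi a) (pi (cstar a))].

Definition semigroup_rep (H : hilbertType R) (T : nat * nat -> H -> H) : Prop :=
  [/\ forall s, bounded_op (T s),
      forall h, T 0 h = h &
      forall s t h, T (s + t) h = T s (T t h)].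

Variable alpha : cstar_dyn.

Record covpair := CovPair {
  cp_space : hilbertType R;
  cp_pi : A -> cp_space -> cp_space;
  cp_T : nat * nat -> cp_space -> cp_space;
  cp_piP : star_representation cp_pi;
  cp_TP : semigroup_rep cp_T;
  cp_cov : forall a s h, cp_pi a (cp_T s h) = cp_T s (cp_pi (alpha s a) h)
}.

Definition contractive (p : covpair) : Prop :=
  forall s (h : cp_space p), `|cp_T s h| <= `|h|.

Definition isometric (p : covpair) : Prop :=
  forall s (h : cp_space p), `|cp_T s h| = `|h|.

(* The inclusion of the space of p into the space of q is a linear map J
   preserving inner products. *)
Definition coextends (q p : covpair) : Prop :=
  exists J : cp_space p -> cp_space q,
    [/\ linear J,
        forall x y, inner (J x) (J y) = inner x y,
        forall a, reducing (cp_pi a) (range J)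
          /\ forall h, cp_pi a (J h) = J (cp_pi a h) &
        forall s, exists Vs Ts,
          [/\ is_adjoint (@cp_T q s) Vs, is_adjoint (@cp_T p s) Ts &
              forall h, Vs (J h) = J (Ts h)]].

Definition c00 := {fsfun nat * nat -> A with 0}.

Definition c00_mul (f g : c00) : c00 :=
  [fsfun u in [fset (s + t)%R | s in finsupp f, t in finsupp g]%fset =>
     \sum_(s <- finsupp f) \sum_(t <- finsupp g | s + t == u)
        cmul (alpha t (f s)) (g t) | 0].

(* The integrated form T x pi, evaluated at f and then at the vector h. *)
Definition integrated (p : covpair) (f : c00) (h : cp_space p) : cp_space p :=
  \sum_(s <- finsupp f) cp_T s (cp_pi (f s) h).

Lemma integrated_mul (p : covpair) (f g : c00) (h : cp_space p) :
  integrated (c00_mul f g) h = integrated f (integrated g h).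
Proof.
have [_ piL piM _] := cp_piP p; have [TB _ TD] := cp_TP p.
have pi0 x : cp_pi 0 x = 0 :> cp_space p.
  by have := piL (-1) 0 0 x; rewrite scaler0 addr0 scaleN1r addNr.
have piD a b x : cp_pi (a + b) x = cp_pi a x + cp_pi b x :> cp_space p.
  by have := piL 1 a b x; rewrite !scale1r.
have pi_sum I (r : seq I) P (a : I -> A) x :
    cp_pi (\sum_(i <- r | P i) a i) x = \sum_(i <- r | P i) cp_pi (a i) x
    :> cp_space p.
  exact: (big_morph (fun a => cp_pi a x) (fun a b => piD a b x) (pi0 x)).
have lin0 (S : cp_space p -> cp_space p) : linear S -> S 0 = 0.
  by move=> SL; have := SL (-1) 0 0; rewrite scaler0 addr0 scaleN1r addNr.
have lin_sum (S : cp_space p -> cp_space p) : linear S ->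
    forall I (r : seq I) P a,
    S (\sum_(i <- r | P i) a i) = \sum_(i <- r | P i) S (a i).
  move=> SL I r P a; apply: (big_morph S) => [x y|]; last exact: lin0.
  by have := SL 1 x y; rewrite !scale1r.
have linpi a : linear (@cp_pi p a) by have [] := cp_piP p => /(_ a) [].
have linTs s : linear (@cp_T p s) by have [] := TB s.
pose S := [fset (s + t)%R | s in finsupp f, t in finsupp g]%fset.
transitivity (\sum_(u <- S) cp_T u (cp_pi (c00_mul f g u) h) : cp_space p).
  rewrite /integrated; apply: big_fset_incl.
    by apply/fsubsetP => u; apply: contraTT => uS;
       rewrite mem_finsupp negbK fsfun_fun (negbTE uS).
  move=> u uS; rewrite memNfinsupp => /eqP ->.
  by rewrite pi0 lin0.
under eq_big_seq => u uS.
  rewrite fsfun_fun uS pi_sum (lin_sum _ (linTs u)).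
  under eq_bigr => s _ do
    (rewrite pi_sum (lin_sum _ (linTs u)) big_mkcond).
  over.
rewrite exchange_big /=; apply: eq_big_seq => s sf.
rewrite exchange_big /= (lin_sum _ (linpi _)) (lin_sum _ (linTs s)).
apply: eq_big_seq => t tg.
rewrite (bigD1_seq (s + t)) ?fset_uniq //=; last exact: in_imfset2.
rewrite eqxx big1 ?addr0 => [|u /negPf].
  2: by rewrite eq_sym => ->.
by rewrite piM TD cp_cov.
Qed.

End DynamicalSystems.

(* For a class C of covariant pairs, the supremum over C of the norms of the
   matrix amplifications of the integrated form is the matrix norm of the image
   of c00 in the bounded product of the B(H), one factor for each pair in C.
   The completion is realized as the closure of that image, with the pointwise
   operations, which extend those of c00 by integrated_mul.  The type opfamily
   is only a carrier: it also contains unbounded and nonlinear families.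
   Matrices are functions of two indices since 'M[opfamily]_n would break
   universe consistency. *)
Section SemicrossedProduct.
Variables (R : realType) (A : cstarAlgType R) (alpha : cstar_dyn A).
Variable C : covpair alpha -> Prop.

Definition opfamily :=
  forall p : {p : covpair alpha | C p}, cp_space (sval p) -> cp_space (sval p).

Definition fam_lin (c : R[i]) (F G : opfamily) : opfamily :=
  fun p h => c *: F p h + G p h.

Definition fam_mul (F G : opfamily) : opfamily := fun p h => F p (G p h).

Definition fam_mxnorm n (F : 'I_n -> 'I_n -> opfamily) : \bar R :=
  ereal_sup [set r | exists p, r = mx_opnorm (fun i j => F i j p)].

Definition canonical_map (f : c00 A) : opfamily :=
  fun p h => integrated f h.

Definition semicrossed_product (F : opfamily) : Prop :=
  (forall p, bounded_op (F p)) /\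
  forall e : R, 0 < e -> exists f : c00 A,
    (fam_mxnorm (fun _ _ : 'I_1 => fam_lin (-1)%R (canonical_map f) F) < e%:E)%E.

End SemicrossedProduct.

Arguments canonical_map {R A alpha} C f.

Definition canonically_completely_isometric (R : realType)
    (A : cstarAlgType R) (alpha : cstar_dyn A) (C D : covpair alpha -> Prop) :
    Prop :=
  exists phi : opfamily C -> opfamily D,
    [/\ forall F, semicrossed_product F -> semicrossed_product (phi F),
        forall G, semicrossed_product G ->
          exists! F, semicrossed_product F /\ phi F = G,
        forall c F G, semicrossed_product F -> semicrossed_product G ->
          phi (fam_lin c F G) = fam_lin c (phi F) (phi G)
          /\ phi (fam_mul F G) = fam_mul (phi F) (phi G),
        forall n (F : 'I_n -> 'I_n -> opfamily C),
          (forall i j, semicrossed_product (F i j)) ->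
          fam_mxnorm (fun i j => phi (F i j)) = fam_mxnorm F &
        forall f : c00 A, phi (canonical_map C f) = canonical_map D f].

(* Main.v *)
(* Let [T1, T2] be the two generators of a contractive covariant pair and
   [Di = sqrt (1 - Ti^* Ti)], which commutes with [pi (alpha_i A)].  The
   isometry [V1 (f0, f1, ..) = (T1 f0, D1 f0, f1, ..)] on the sum of [H] and
   countably many copies of the closed range of [D1] is covariant for
   [sigma a = sum_n pi (alpha_1^n a)].  Since
   [|D2 T1 h|^2 + |D1 h|^2 = |D1 T2 h|^2 + |D2 h|^2], there is a partial
   isometry [w] with [w (D2 T1 h, D1 h) = (D1 T2 h, D2 h)], and it intertwines
   the representations involved.  Running [w] as a linear system with initial
   state [D2 f0] and inputs [f1, f2, ..] lifts [T2] to a covariant contraction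
   [S2] commuting with [V1], which is isometric as soon as [T2] is.  Applying
   the same construction to [(S2, V1)] makes both generators isometric.
   If [q] co-extends [p] along [J], an element [F] of the semicrossed product
   satisfies [F p = J^* (F q) J]; so restricting families to the isometric
   pairs loses neither elements nor norms. *)

Require Import Defs.
From HB Require Import structures.
From mathcomp Require Import all_boot all_order all_algebra finmap complex.
From mathcomp Require Import all_classical all_reals all_analysis.
From mathcomp Require Import ring lra.

Set Implicit Arguments.
Unset Strict Implicit.
Unset Printing Implicit Defensive.

Import Order.TTheory GRing.Theory Num.Theory.
Import numFieldNormedType.Exports.

Local Open Scope classical_set_scope.
Local Open Scope ring_scope.
Local Open Scope complex_scope.

(** * Norm convergence over [R[i]] *)

(** Ando's theorem is usually proved by extending [w] to a unitary on a larger space. Here such a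
    unitary would also have to intertwine two different representations. Extending [w] by zero keeps
    the intertwining; the price is that the lifting [S2] is only a contraction, hence the second
    round. There one of the two defects vanishes, and [w] meets only inputs from the closed range of
    the other, where it is isometric. This is why the summands are cut down to closed ranges.

    [Di] commutes with [pi (alpha_i A)] because [Ti^* Ti] does, and the square root is a limit of
    polynomials in [Ti^* Ti]. The sum of the [pi (alpha_1^n a)] is bounded because star
    representations are contractive; their definition gives mere boundedness, and contractivity
    comes from the same square root iteration run inside [A]. As [alpha 0] need not be the identity,
    the dilated representation must satisfy [sigma (alpha 0 a) = sigma a]; [pi] does by covariance
    at [0], and the construction passes it on. *)

Section PlainLinearMaps.
Variables (K : pzRingType) (U V : lmodType K) (S : U -> V).
Hypothesis SL : linear S.

Lemma lin0 : S 0 = 0.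
Proof. by have := SL (-1) 0 0; rewrite scaler0 addr0 scaleN1r addNr. Qed.

Lemma linZ c x : S (c *: x) = c *: S x.
Proof. by have := SL c x 0; rewrite addr0 lin0 addr0. Qed.

Lemma linD x y : S (x + y) = S x + S y.
Proof. by have := SL 1 x y; rewrite !scale1r. Qed.

Lemma linN x : S (- x) = - S x.
Proof. by rewrite -scaleN1r linZ scaleN1r. Qed.

Lemma linB x y : S (x - y) = S x - S y.
Proof. by rewrite linD linN. Qed.

End PlainLinearMaps.

Lemma ltc_Re (R : rcfType) (x y : R[i]) : x < y -> complex.Re x < complex.Re y.
Proof. by rewrite ltcE => /andP[]. Qed.

Lemma lec_Re (R : rcfType) (x y : R[i]) : x <= y -> complex.Re x <= complex.Re y.
Proof. by rewrite lecE => /andP[]. Qed.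

Lemma rcvg_le (R : realType) (u v : nat -> R) (a b : R) :
  u @ \oo --> a -> v @ \oo --> b -> (forall n, u n <= v n) -> a <= b.
Proof.
move=> ua vb uv; rewrite -subr_ge0.
by apply: (cvgr_to_ge (cvgB vb ua)); apply: nearW => n; rewrite subr_ge0 uv.
Qed.

(** Norms take values in [R[i]]; stating convergence through a real sequence makes the real squeeze
    and order lemmas available. *)
Definition ctends (R : realType) (V : normedModType R[i]) (u : nat -> V) (l : V) :=
  (fun n => complex.Re `|u n - l|) @ \oo --> (0 : R).

Section ComplexNormedModules.
Variables (R : realType) (V : normedModType R[i]).
Implicit Types (x y : V) (c : R[i]) (a : R) (u v : nat -> V).

Local Notation nrm x := (complex.Re `|x|).

Lemma norm_realE x : `|x| = (nrm x)%:C.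
Proof. by rewrite RRe_real // ger0_real. Qed.

Lemma nrm_ge0 x : 0 <= nrm x.
Proof. by have := normr_ge0 x; rewrite norm_realE ler0c. Qed.

Lemma nrmD x y : nrm (x + y) <= nrm x + nrm y.
Proof.
by have := ler_normD x y; rewrite (norm_realE x) (norm_realE y) (norm_realE (x + y)) -rmorphD lecR.
Qed.

Lemma nrmN x : nrm (- x) = nrm x.
Proof. by rewrite normrN. Qed.

Lemma nrmZ a x : nrm (a%:C *: x) = `|a| * nrm x.
Proof.
rewrite normrZ (norm_realE x).
have -> : `|a%:C| = `|a|%:C by rewrite normc_def /= expr0n addr0 sqrtr_sqr.
by rewrite -rmorphM.
Qed.

Lemma nrmZc c x : nrm (c *: x) = complex.Re `|c| * nrm x.
Proof. by rewrite normrZ (norm_realE x) normc_def -rmorphM. Qed.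

Lemma nrm_eq0 x : nrm x = 0 -> x = 0.
Proof. by move=> h; apply/normr0_eq0; rewrite norm_realE h. Qed.

Lemma nrmB x y : nrm (x - y) = nrm (y - x).
Proof. by rewrite -nrmN opprB. Qed.

Lemma nrm_split x y z : nrm (x - y) <= nrm (x - z) + nrm (y - z).
Proof. by rewrite (nrmB y z) (le_trans _ (nrmD _ _)) // addrA subrK. Qed.

Lemma nrm_le (x : V) (W : normedModType R[i]) (y : W) :
  (`|x| <= `|y|) = (nrm x <= complex.Re `|y|).
Proof.
rewrite norm_realE; have -> : `|y| = (complex.Re `|y|)%:C by rewrite RRe_real // ger0_real.
by rewrite lecR.
Qed.

Lemma ctends_le u l (b : nat -> R) :
  (forall n, nrm (u n - l) <= b n) -> b @ \oo --> (0 : R) -> ctends u l.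
Proof.
move=> ub b0; apply: (squeeze_cvgr _ (cvg_cst 0) b0).
by apply: nearW => n; rewrite nrm_ge0 ub.
Qed.

Lemma ctends_uniq u l l' : ctends u l -> ctends u l' -> l = l'.
Proof.
move=> ul ul'; apply/eqP; rewrite -subr_eq0; apply/eqP/nrm_eq0/eqP.
rewrite eq_le nrm_ge0 andbT -(addr0 0).
apply: (rcvg_le (cvg_cst _) (cvgD ul ul')) => n.
by have := nrm_split l l' (u n); rewrite (nrmB l (u n)) (nrmB l' (u n)).
Qed.

Lemma ctends_nrm u l : ctends u l -> (fun n => nrm (u n)) @ \oo --> nrm l.
Proof.
move=> ul; apply/cvgrPdist_le => e e0; near=> n.
have h : nrm (u n - l) <= e.
  by near: n; move/cvgrPdist_le : ul => /(_ e e0); apply: filterS => n;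
    rewrite sub0r normrN ger0_norm // nrm_ge0.
rewrite (le_trans _ h) // ler_norml; apply/andP; split.
  by rewrite lerNl opprB lerBlDr (le_trans _ (nrmD _ _)) // subrK.
by rewrite nrmB lerBlDr (le_trans _ (nrmD _ _)) // subrK.
Unshelve. all: by end_near. Qed.

Lemma ctends_cst l : @ctends R V (fun=> l) l.
Proof. by rewrite /ctends subrr normr0; apply: cvg_cst. Qed.

Lemma ctendsD u v l l' : ctends u l -> ctends v l' -> @ctends R V (fun n => u n + v n) (l + l').
Proof.
move=> ul vl; apply: (ctends_le _ (b := fun n => nrm (u n - l) + nrm (v n - l'))).
  by move=> n; rewrite opprD addrACA nrmD.
by rewrite -(addr0 0); exact: cvgD.
Qed.

Lemma ctends_lip (W : normedModType R[i]) (S : V -> W) M u l :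
  (forall x y, complex.Re `|S x - S y| <= M * nrm (x - y)) -> ctends u l ->
  @ctends R W (fun n => S (u n)) (S l).
Proof.
move=> SM ul; apply: (squeeze_cvgr _ (cvg_cst 0)); last first.
  by rewrite -(mulr0 M); apply: cvgM ul; exact: cvg_cst.
apply: nearW => n; rewrite SM andbT.
by have := normr_ge0 (S (u n) - S l); rewrite lecE => /andP[].
Qed.

Lemma ctendsS u l : ctends u l -> @ctends R V (fun n => u n.+1) l.
Proof. by rewrite /ctends -(cvg_shiftS (fun n => nrm (u n - l))). Qed.

End ComplexNormedModules.

Lemma complete_ctends (R : realType) (V : completeNormedModType R[i])
    (u : nat -> V) (b : nat -> R) :
  b @ \oo --> (0 : R) ->
  (forall n m, (n <= m)%N -> complex.Re `|u n - u m| <= b n) ->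
  exists l, ctends u l.
Proof.
move=> b0 ub.
have /cauchy_cvg /cvg_ex [l ul] : cauchy (u @ \oo).
  apply: cauchy_exP => e e0.
  have e1 : e = (complex.Re e)%:C by rewrite RRe_real // gtr0_real.
  have e2 : 0 < complex.Re e by move: e0; rewrite ltcE => /andP[].
  move/cvgr_lt : b0 => /(_ _ e2) [N _ bN].
  exists (u N); exists N => // m Nm; rewrite -ball_normE /= norm_realE e1.
  have := le_lt_trans (ub _ _ Nm) (bN _ (leqnn N)); rewrite -ltcR; exact.
exists l; apply/cvgrPdist_lt => e e0.
have ec : (0 : R[i]) < e%:C by rewrite ltcE /= eqxx.
move/cvgrPdist_lt : ul => /(_ e%:C ec).
apply: filterS => n /ltc_Re /= h.
by rewrite sub0r normrN ger0_norm ?nrm_ge0 // nrmB.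
Qed.

(** * Hilbert spaces *)

Section RealInnerProduct.
Variables (R : realType) (H : hilbertType R).
Implicit Types (x y z : H) (c : R[i]) (a b : R).

(** Norms and adjoints are governed by this real part; pairing with ['i *: z] recovers the imaginary
    part where [inner] itself is required. *)
Definition rdot x y : R := complex.Re (inner x y).

Lemma innerDl x y z : inner (x + y) z = inner x z + inner y z.
Proof. exact: linearDl. Qed.

Lemma innerZl c x z : inner (c *: x) z = c * inner x z.
Proof. exact: linearZl_LR. Qed.

Lemma innerC x y : inner x y = (inner y x)^*%C.
Proof. by rewrite hermC /= expr0 mul1r. Qed.

Lemma rdotC x y : rdot x y = rdot y x.
Proof. by rewrite /rdot innerC; case: (inner y x). Qed.

Lemma rdotDl x y z : rdot (x + y) z = rdot x z + rdot y z.
Proof. by rewrite /rdot innerDl; case: (inner x z); case: (inner y z). Qed.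

Lemma rdotZl c x z : rdot (c *: x) z =
  complex.Re c * rdot x z - complex.Im c * complex.Im (inner x z).
Proof. by rewrite /rdot innerZl; case: c (inner x z) => [a b] [d e]. Qed.

Lemma rdotDr x y z : rdot x (y + z) = rdot x y + rdot x z.
Proof. by rewrite rdotC rdotDl !(rdotC x). Qed.

Lemma rdotRl a x z : rdot (a%:C *: x) z = a * rdot x z.
Proof. by rewrite rdotZl /= mul0r subr0. Qed.

Lemma rdotRr a x z : rdot x (a%:C *: z) = a * rdot x z.
Proof. by rewrite rdotC rdotRl rdotC. Qed.

Lemma rdotNl x z : rdot (- x) z = - rdot x z.
Proof. by rewrite -scaleN1r; have := rdotRl (-1) x z; rewrite rmorphN1 mulN1r. Qed.

Lemma rdotNr x z : rdot x (- z) = - rdot x z.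
Proof. by rewrite rdotC rdotNl rdotC. Qed.

Lemma rdotBl x y z : rdot (x - y) z = rdot x z - rdot y z.
Proof. by rewrite rdotDl rdotNl. Qed.

Lemma rdotBr x y z : rdot x (y - z) = rdot x y - rdot x z.
Proof. by rewrite rdotDr rdotNr. Qed.

Lemma rdot0l z : rdot 0 z = 0.
Proof. by rewrite -(subrr z) rdotBl subrr. Qed.

Lemma rdot0r z : rdot z 0 = 0.
Proof. by rewrite rdotC rdot0l. Qed.

Lemma innerZr c x z : inner x (c *: z) = (c^*)%C * inner x z.
Proof. by rewrite innerC innerZl rmorphM /= -innerC. Qed.

Lemma rdotZ c x z : rdot (c *: x) z = rdot x ((c^*)%C *: z).
Proof. by rewrite /rdot innerZl innerZr conjcK. Qed.

Lemma innerDr x y z : inner x (y + z) = inner x y + inner x z.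
Proof. by rewrite innerC innerDl rmorphD /= -!innerC. Qed.

Lemma innerNr x z : inner x (- z) = - inner x z.
Proof. by rewrite -scaleN1r innerZr rmorphN1 mulN1r. Qed.

Lemma inner0r x : inner x 0 = 0.
Proof. by rewrite -(scale0r (0 : H)) innerZr rmorph0 mul0r. Qed.

Lemma Im_inner x z : complex.Im (inner x z) = rdot x ('i%C *: z).
Proof. by rewrite /rdot innerZr; case: (inner x z) => a b /=; ring. Qed.

Lemma inner_eq0 x z : rdot x z = 0 -> rdot x ('i%C *: z) = 0 -> inner x z = 0.
Proof. by rewrite -Im_inner /rdot; case: (inner x z) => a b /= -> ->. Qed.

Lemma rnormE x : rnorm x ^+ 2 = rdot x x.
Proof.
by have /(congr1 (@complex.Re _)) := norm_inner x; rewrite norm_realE -rmorphXn.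
Qed.

Lemma rdot_ge0 x : 0 <= rdot x x.
Proof. by rewrite -rnormE sqr_ge0. Qed.

Lemma rdot_eq0 x : rdot x x = 0 -> x = 0.
Proof.
by rewrite -rnormE => /eqP; rewrite expf_eq0 /= => /eqP; exact: nrm_eq0.
Qed.

Lemma rdot_inj x y : (forall z, rdot z x = rdot z y) -> x = y.
Proof.
move=> h; apply/eqP; rewrite -subr_eq0; apply/eqP/rdot_eq0.
by rewrite rdotBr h subrr.
Qed.

Lemma rdot_cauchy_schwarz x y : `|rdot x y| <= rnorm x * rnorm y.
Proof.
rewrite -(ler_pXn2r (n := 2)) ?nnegrE ?mulr_ge0 ?nrm_ge0 // exprMn !rnormE.
rewrite real_normK ?num_real //.
have [y0|y0] := eqVneq (rdot y y) 0.
  by rewrite (rdot_eq0 y0) rdot0r expr0n rdot0l mulr0.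
have := rdot_ge0 ((rdot y y)%:C *: x - (rdot x y)%:C *: y).
rewrite !(rdotBl, rdotBr, rdotRl, rdotRr) (rdotC y x) => h.
have yp : 0 < rdot y y by rewrite lt_neqAle eq_sym y0 rdot_ge0.
rewrite -subr_ge0 -(pmulr_rge0 _ yp); move: h; congr (0 <= _); ring.
Qed.

Lemma rdot_le x y : rdot x y <= rnorm x * rnorm y.
Proof. exact: le_trans (ler_norm _) (rdot_cauchy_schwarz _ _). Qed.

Lemma ctends_rdot (u : nat -> H) l z :
  ctends u l -> (fun n => rdot (u n) z) @ \oo --> rdot l z.
Proof.
move=> ul; have h : (fun n => complex.Re `|u n - l| * rnorm z) @ \oo --> (0 : R).
  by rewrite -(mul0r (rnorm z)); apply: cvgM ul (cvg_cst _).
have : (fun n => rdot (u n) z - rdot l z) @ \oo --> (0 : R).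
  apply: (squeeze_cvgr _ (_ : - (fun n => complex.Re `|u n - l| * rnorm z) @ \oo --> (0:R)) h).
    by apply: nearW => n; rewrite -ler_norml -rdotBl rdot_cauchy_schwarz.
  by rewrite -oppr0; exact: cvgN.
by move=> /subr_cvg0.
Qed.

End RealInnerProduct.

Lemma eq_inner_rdot (R : realType) (H H' : hilbertType R) (x z : H) (x' z' : H') :
  rdot x' z' = rdot x z -> rdot x' ('i%C *: z') = rdot x ('i%C *: z) ->
  inner x' z' = inner x z.
Proof.
rewrite -!Im_inner /rdot.
by case: (inner x z) (inner x' z') => [a b] [c d] /= -> ->.
Qed.

(** * Riesz representation, adjoints and partial isometries *)

Section Riesz.
Variables (R : realType) (H : hilbertType R) (X : lmodType R[i]).
Variables (Q : X -> H) (phi : X -> R) (C : R).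
Hypothesis Qlin : linear Q.
Hypothesis philin : forall (a : R) x y, phi (a%:C *: x + y) = a * phi x + phi y.
Hypothesis C_ge0 : 0 <= C.
Hypothesis phi_le : forall x, phi x <= C * rnorm (Q x).

Let F x := rdot (Q x) (Q x) - 2 * phi x.

Let FD (a b : R) x y : F (a%:C *: x + b%:C *: y) =
  a ^+ 2 * rdot (Q x) (Q x) + b ^+ 2 * rdot (Q y) (Q y)
  + 2 * a * b * rdot (Q x) (Q y) - 2 * (a * phi x + b * phi y).
Proof.
have phi0 : phi 0 = 0.
  by have := philin 1 0 0; rewrite scaler0 addr0 mul1r => h; lra.
have phiZ c u : phi (c%:C *: u) = c * phi u.
  by have := philin c u 0; rewrite addr0 phi0 addr0.
rewrite /F philin Qlin phiZ (linZ Qlin) !(rdotDl, rdotDr, rdotRl, rdotRr).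
rewrite (rdotC (Q y) (Q x)); ring.
Qed.

Let F_ge x : - C ^+ 2 <= F x.
Proof.
have := phi_le x; rewrite /F -rnormE.
have := sqr_ge0 (rnorm (Q x) - C); rewrite sqrrB; set r := rnorm _; nra.
Qed.

Let m := inf (range F).

Let Fm x : m <= F x.
Proof.
apply: ge_inf; last by exists x.
by exists (- C ^+ 2) => _ [y _ <-]; exact: F_ge.
Qed.

(* Minimizing [|Q x|^2 - 2 phi x] handles adjoints ([Q = id]) and the
   extension of partial isometries by continuity at once. *)
Lemma riesz_range : exists z : H,
  [/\ forall x, rdot (Q x) z = phi x,
      forall v, (forall x, rdot (Q x) v = 0) -> rdot z v = 0 &
      rnorm z <= C].
Proof.
have [x Fx] : {x : nat -> X & forall n, F (x n) < m + harmonic n}.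
  apply: (@boolp.choice _ _ (fun n y => F y < m + harmonic n)) => n.
  have [] := @inf_adherent R (range F) (harmonic n).
  - by rewrite harmonic_gt0.
  - split; first by exists (F 0); exists 0.
    by exists (- C ^+ 2) => _ [y _ <-]; exact: F_ge.
  - by move=> _ [y _ <-] ?; exists y.
(* Parallelogram identity: [|Q xn - Q xk|^2 = 2 F xn + 2 F xk - 4 F ((xn + xk) / 2)], at most
   [4 * harmonic n] when [n <= k]. *)
have hc : (fun n => Num.sqrt (4 * harmonic n)) @ \oo --> (0 : R).
  rewrite -(sqrtr0 R).
  suff c4 : (fun n => 4 * harmonic n) @ \oo --> (0 : R).
    exact: (cvg_comp _ _ c4 (@sqrt_continuous R 0)).
  by rewrite -(mulr0 4); apply: cvgM (cvg_cst _) _; exact: cvg_harmonic.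
have [z xz] : exists z, ctends (fun n => Q (x n)) z.
  apply: (complete_ctends hc) => n k nk.
  rewrite -(ler_pXn2r (n := 2)) ?nnegrE ?nrm_ge0 ?sqrtr_ge0 //.
  have h0 : 0 <= harmonic n :> R by rewrite ltW ?harmonic_gt0.
  rewrite sqr_sqrtr ?mulr_ge0 // [leLHS]rnormE !(rdotBl, rdotBr).
  rewrite (rdotC (Q (x k)) (Q (x n))).
  have := Fm ((2^-1)%:C *: x n + (2^-1)%:C *: x k); rewrite FD.
  have : harmonic k <= harmonic n :> R by rewrite /= lef_pV2 ?posrE // ler_nat.
  have := Fx n; have := Fx k; rewrite /F.
  set hn := harmonic n; set hk := harmonic k.
  set p := rdot (Q (x n)) (Q (x n)); set q := rdot (Q (x k)) (Q (x k)).
  set r := rdot _ _; move: (phi _) (phi _) => f1 f2 *; lra.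
have rz y : rdot (Q y) z = phi y.
  (* Perturbing the minimizing sequence by [t y] cannot push [F] below [m]; the limit is the
     first-variation inequality. *)
  have key t : 0 <= 2 * t * (rdot z (Q y) - phi y) + t ^+ 2 * rdot (Q y) (Q y).
    have c : (fun n => 2 * t * (rdot (Q (x n)) (Q y) - phi y)
        + t ^+ 2 * rdot (Q y) (Q y) + harmonic n) @ \oo -->
        2 * t * (rdot z (Q y) - phi y) + t ^+ 2 * rdot (Q y) (Q y) + 0.
      apply: cvgD; last exact: cvg_harmonic.
      apply: cvgD (cvg_cst _); apply: cvgM (cvg_cst _) _.
      by apply: cvgD (cvg_cst _); exact: ctends_rdot.
    rewrite -[leRHS]addr0; apply: (rcvg_le (cvg_cst 0) c) => n.
    have h1 := Fx n; have h2 := Fm ((1 : R)%:C *: x n + t%:C *: y).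
    have -> : 2 * t * (rdot (Q (x n)) (Q y) - phi y) + t ^+ 2 * rdot (Q y) (Q y) =
      F ((1 : R)%:C *: x n + t%:C *: y) - F (x n) by rewrite FD /F; ring.
    by move: (F _) (F _) (harmonic n) h1 h2 => a b h h1 h2; rewrite /=; lra.
  rewrite rdotC; apply/eqP; rewrite -subr_eq0; apply/eqP.
  move: key; move: (rdot z (Q y) - phi y) => d key.
  have q0 := rdot_ge0 (Q y); move: (rdot (Q y) _) q0 key => q q0 key.
  apply/eqP; case: (eqVneq d 0) => // d0; exfalso.
  have d2 : 0 < d ^+ 2 by rewrite lt_neqAle sqr_ge0 eq_sym sqrf_eq0 d0.
  have q1 : 0 < q + 1 by lra.
  (* Adding 1 to [q] keeps a nearly optimal [t] defined when [q = 0]. *)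
  have := key (- d / (q + 1)); apply/negP; rewrite -ltNge.
  have -> : 2 * (- d / (q + 1)) * d + (- d / (q + 1)) ^+ 2 * q =
    - (d ^+ 2 / (q + 1) ^+ 2) * (q + 2) by field; rewrite gt_eqF.
  have q2 : 0 < q + 2 by lra.
  by rewrite mulNr oppr_lt0 mulr_gt0 // divr_gt0 // exprn_gt0.
exists z; split=> // [v vQ|].
  have := ctends_rdot (z := v) xz.
  under eq_fun do rewrite vQ.
  by move=> h; apply/esym/(cvg_unique _ (cvg_cst 0) h).
(* [|z|^2] is the limit of [rdot (Q (x n)) z = phi (x n)], bounded by [C |Q (x n)|], which tends to
   [C |z|]. *)
have h : rnorm z * rnorm z <= C * rnorm z.
  rewrite -expr2 rnormE.
  apply: (rcvg_le (ctends_rdot (z := z) xz) (v := fun n => C * rnorm (Q (x n)))).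
    by apply: cvgM (cvg_cst _) _; exact: ctends_nrm.
  by move=> n; rewrite rz.
have [z0|z0] := eqVneq (rnorm z) 0; first by rewrite z0.
by rewrite ler_pM2r // in h; rewrite lt_neqAle eq_sym z0 nrm_ge0.
Qed.

End Riesz.

Lemma bounded_opP (R : realType) (H : hilbertType R) (S : H -> H) :
  bounded_op S -> linear S /\
  exists2 M : R, 0 <= M & forall x, rnorm (S x) <= M * rnorm x.
Proof.
move=> [SL [M SM]]; split=> //; exists `|complex.Re M| => // x.
have /lec_Re := SM x; rewrite (norm_realE x) => h; apply: (le_trans h).
rewrite -/(rnorm x); case: M {SM h} => a b /=.
by rewrite mulr0 subr0 ler_wpM2r ?nrm_ge0 // ler_norm.
Qed.

Lemma rnorm_bounded_op (R : realType) (H : hilbertType R) (S : H -> H) M :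
  linear S -> (forall x, rnorm (S x) <= M * rnorm x) -> bounded_op S.
Proof.
move=> SL SM; split=> //; exists M%:C => x.
by rewrite (norm_realE x) (norm_realE (S x)) -rmorphM lecR; exact: SM.
Qed.

Section Adjoints.
Variables (R : realType) (H1 H2 : hilbertType R).

Lemma rdot_adj_linear (S : H1 -> H2) (S' : H2 -> H1) : linear S ->
  (forall x y, rdot (S x) y = rdot x (S' y)) -> linear S'.
Proof.
move=> SL adj c y y'; apply: rdot_inj => z.
rewrite -adj !rdotDr -[in LHS](conjcK c) -rdotZ -(linZ SL) adj rdotZ conjcK.
by rewrite adj.
Qed.

Lemma rdot_adj_inner (S : H1 -> H2) (S' : H2 -> H1) : linear S ->
  (forall x y, rdot (S x) y = rdot x (S' y)) ->
  forall x y, inner (S x) y = inner x (S' y).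
Proof.
move=> SL adj x y; apply: eq_inner_rdot; first exact: adj.
by rewrite adj (linZ (rdot_adj_linear SL adj)).
Qed.

Lemma exists_adjoint (S : H1 -> H2) M : linear S -> 0 <= M ->
  (forall x, rnorm (S x) <= M * rnorm x) ->
  exists S' : H2 -> H1,
    [/\ linear S', forall x y, rdot (S x) y = rdot x (S' y)
      & forall y, rnorm (S' y) <= M * rnorm y].
Proof.
move=> SL M0 SM.
have [S' S'P] : {S' : H2 -> H1 & forall y,
    (forall x, rdot x (S' y) = rdot (S x) y) /\ rnorm (S' y) <= M * rnorm y}.
  apply: (@boolp.choice _ _ (fun y z =>
    (forall x, rdot x z = rdot (S x) y) /\ rnorm z <= M * rnorm y)) => y.
  have [] := @riesz_range R H1 H1 id (fun x => rdot (S x) y) (M * rnorm y).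
  - by [].
  - by move=> a x x'; rewrite SL rdotDl rdotRl.
  - by rewrite mulr_ge0 ?nrm_ge0.
  - move=> x; apply: le_trans (rdot_le _ _) _.
    by rewrite mulrAC ler_wpM2r ?nrm_ge0.
  - by move=> z [h1 _ h2]; exists z.
have adj x y : rdot (S x) y = rdot x (S' y) by have [->] := S'P y.
exists S'; split=> //; first exact: rdot_adj_linear SL adj.
by move=> y; have [] := S'P y.
Qed.

End Adjoints.

Section PartialIsometry.
Variables (R : realType) (X : lmodType R[i]) (H1 H2 : hilbertType R).
Variables (P : X -> H1) (Q : X -> H2).
Hypothesis (PL : linear P) (QL : linear Q).
Hypothesis PQ : forall x y, rdot (P x) (P y) = rdot (Q x) (Q y).

(** The closed range of [Q] is expressed as double orthogonality, with no closure taken. The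
    difference of two such vectors with equal pairings is orthogonal to the range, hence to
    itself. *)
Lemma range_uniq (z z' : H2) :
  (forall v, (forall x, rdot (Q x) v = 0) -> rdot z v = 0) ->
  (forall v, (forall x, rdot (Q x) v = 0) -> rdot z' v = 0) ->
  (forall x, rdot (Q x) z = rdot (Q x) z') -> z = z'.
Proof.
move=> hz hz' h; apply/eqP; rewrite -subr_eq0; apply/eqP/rdot_eq0.
have k x : rdot (Q x) (z - z') = 0 by rewrite rdotBr h subrr.
by rewrite rdotBl hz // hz' // subrr.
Qed.

(** The functional [x |-> rdot (P x) y] is bounded by [|y| |Q x|] because [|P x| = |Q x|]; its Riesz
    vector in the closed range of [Q] is [w y]. So [w] is the continuous extension of [P x |-> Q x],
    zero on the orthogonal complement of the range of [P]. *)
Lemma range_transfer : exists w : H1 -> H2,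
  [/\ forall x y, rdot (Q x) (w y) = rdot (P x) y,
      forall y v, (forall x, rdot (Q x) v = 0) -> rdot (w y) v = 0
    & forall y, rnorm (w y) <= rnorm y].
Proof.
have [w wP] : {w : H1 -> H2 & forall y,
    [/\ forall x, rdot (Q x) (w y) = rdot (P x) y,
      forall v, (forall x, rdot (Q x) v = 0) -> rdot (w y) v = 0
    & rnorm (w y) <= rnorm y]}.
  apply: (@boolp.choice _ _ (fun y z =>
    [/\ forall x, rdot (Q x) z = rdot (P x) y,
      forall v, (forall x, rdot (Q x) v = 0) -> rdot z v = 0
    & rnorm z <= rnorm y])) => y.
  apply: (@riesz_range R H2 X Q (fun x => rdot (P x) y) (rnorm y)) => //.
  - by move=> a x x'; rewrite PL rdotDl rdotRl.
  - by rewrite nrm_ge0.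
  - move=> x; rewrite mulrC.
    have -> : rnorm (Q x) = rnorm (P x).
      by apply/eqP; rewrite -(eqrXn2 (n := 2)) ?nrm_ge0 // !rnormE PQ.
    exact: rdot_le.
by exists w; split=> [x y|y v|y]; have [h1 h2 h3] := wP y => //; exact: h2.
Qed.

End PartialIsometry.

(** The transfers in the two directions are inverse to each other between the closed ranges; as both
    are contractions, [w] preserves norms on the closed range of [P]. *)
Lemma partial_isometry (R : realType) (X : lmodType R[i]) (H1 H2 : hilbertType R)
    (P : X -> H1) (Q : X -> H2) : linear P -> linear Q ->
  (forall x y, rdot (P x) (P y) = rdot (Q x) (Q y)) ->
  exists w : H1 -> H2,
  [/\ linear w /\ (forall x, w (P x) = Q x),
      forall x y, rdot (Q x) (w y) = rdot (P x) y,
      forall y v, (forall x, rdot (Q x) v = 0) -> rdot (w y) v = 0,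
      forall y, rnorm (w y) <= rnorm y &
      forall y, (forall v, (forall x, rdot (P x) v = 0) -> rdot y v = 0) ->
        rnorm (w y) = rnorm y].
Proof.
move=> PL QL PQ; have [w [w1 w2 w3]] := range_transfer PL QL PQ.
have [|w' [w1' w2' w3']] := range_transfer QL PL; first by move=> *; rewrite PQ.
exists w; split=> //.
- split=> [c y y'|x].
    apply: (range_uniq (Q := Q)) => [v /w2 //|v vQ|x].
      rewrite rdotDl rdotZ !w2 ?addr0 // => x.
      by rewrite -rdotZ -(linZ QL) vQ.
    rewrite w1 !rdotDr w1; congr (_ + _).
    by rewrite -(conjcK c) -!rdotZ -(linZ QL) -(linZ PL) w1.
  apply: (range_uniq (Q := Q)) => [v /w2 //|v vQ|x']; first exact: vQ.
  by rewrite w1 PQ.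
- move=> y yP; apply/eqP; rewrite eq_le w3 /=.
  suff {1}-> : y = w' (w y) by exact: w3'.
  by apply: (range_uniq (Q := P)) => [v /yP //|v /w2' //|x]; rewrite w1' w1.
Qed.

(** * Square roots *)

(* The iteration [y |-> (b + y^2) / 2] starting at [0] converges to
   [1 - sqrt (1 - b)]; its increments are dominated by those of the scalar
   iteration for [b = 1], so that no spectral theory is needed. *)
Section ScalarIteration.
Variable R : realType.

Fixpoint sqrt_iter (n : nat) : R :=
  if n is k.+1 then (1 + sqrt_iter k ^+ 2) / 2 else 0.

Lemma sqrt_iter_bound n : 0 <= sqrt_iter n <= 1.
Proof.
elim: n => [|n /andP[h0 h1]] /=; first by rewrite lexx ler01.
have h2 : sqrt_iter n ^+ 2 <= 1 by rewrite expr_le1.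
have := sqr_ge0 (sqrt_iter n); lra.
Qed.

Lemma sqrt_iter_leS n : sqrt_iter n <= sqrt_iter n.+1.
Proof. by rewrite /= ler_pdivlMr //; have := sqr_ge0 (sqrt_iter n - 1); nra. Qed.

(** Increments telescope against a bounded monotone sequence, whose tail is then a Cauchy modulus;
    the value of the scalar limit never enters. *)
Lemma sqrt_iter_dominated (V : completeNormedModType R[i]) (u : nat -> V) (C : R) :
  0 <= C ->
  (forall n, complex.Re `|u n.+1 - u n| <= (sqrt_iter n.+1 - sqrt_iter n) * C) ->
  exists l, ctends u l.
Proof.
move=> C0 uC.
have nd : nondecreasing_seq sqrt_iter by apply/nondecreasing_seqP; exact: sqrt_iter_leS.
have cv : cvgn sqrt_iter.
  apply: nondecreasing_is_cvgn => //; exists 1 => _ [n _ <-].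
  by have /andP[] := sqrt_iter_bound n.
apply: (@complete_ctends _ _ _ (fun n => (limn sqrt_iter - sqrt_iter n) * C)).
  rewrite -(mul0r C); apply: cvgM (cvg_cst _).
  by rewrite -(subrr (limn sqrt_iter)); apply: cvgB cv; exact: cvg_cst.
move=> n m nm; apply: (@le_trans _ _ ((sqrt_iter m - sqrt_iter n) * C)).
  elim: m nm => [|m IH]; first by rewrite leqn0 => /eqP ->; rewrite !subrr normr0 mul0r.
  rewrite leq_eqVlt => /predU1P[->|]; first by rewrite !subrr normr0 mul0r.
  rewrite ltnS => /IH {}IH; apply: le_trans (nrm_split _ _ (u m)) _.
  apply: le_trans (lerD IH (uC m)) _.
  by rewrite -mulrDl addrC addrA subrK.
by rewrite ler_wpM2r // lerB // nondecreasing_cvgn_le.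
Qed.

End ScalarIteration.

Section OperatorRoot.
Variables (R : realType) (H : hilbertType R) (B : H -> H).
Hypothesis BL : linear B.
Hypothesis Bcontr : forall x, rnorm (B x) <= rnorm x.
Hypothesis Bsym : forall x y, rdot (B x) y = rdot x (B y).

Let half : R[i] := (2^-1 : R)%:C.

Fixpoint op_iter (n : nat) (h : H) : H :=
  if n is k.+1 then half *: (B h + op_iter k (op_iter k h)) else 0.

Lemma op_iter_lin n : linear (op_iter n).
Proof.
elim: n => [|n IH] c x y /=; first by rewrite scaler0 addr0.
rewrite BL !IH scalerA (mulrC c) -scalerA -scalerDr; congr (_ *: _).
by rewrite scalerDr addrACA.
Qed.

Lemma op_iter_le n x : rnorm (op_iter n x) <= sqrt_iter R n * rnorm x.
Proof.
elim: n x => [|n IH] x /=; first by rewrite /rnorm normr0 mul0r.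
rewrite /rnorm nrmZ ger0_norm ?invr_ge0 // (mulrC _ 2^-1) -mulrA ler_pM2l ?invr_gt0 //.
apply: le_trans (nrmD _ _) _; rewrite mulrDl mul1r lerD ?Bcontr //.
apply: le_trans (IH _) _; rewrite expr2 -mulrA ler_wpM2l //.
by have /andP[] := sqrt_iter_bound R n.
Qed.

(** From [u^2 - v^2 = u (u - v) + (u - v) v], which asks for no commutation; the scalar iteration
    satisfies the same identity, so the bounds match term by term. *)
Lemma op_iter_diff n x : rnorm (op_iter n.+1 x - op_iter n x) <=
  (sqrt_iter R n.+1 - sqrt_iter R n) * rnorm x.
Proof.
elim: n x => [|n IH] x.
  rewrite /= addr0 !subr0 expr0n addr0 /rnorm nrmZ ger0_norm ?invr_ge0 // mul1r.
  by rewrite ler_pM2l ?invr_gt0 // Bcontr.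
rewrite [op_iter n.+2 x]/= [in X in _ - X]/= -scalerBr.
rewrite opprD addrACA subrr add0r /rnorm nrmZ ger0_norm ?invr_ge0 //.
have -> : half *: (B (half *: (B x + op_iter n (op_iter n x))) +
    op_iter n (op_iter n (half *: (B x + op_iter n (op_iter n x))))) =
    op_iter n.+1 (op_iter n.+1 x) by [].
have -> : op_iter n.+1 (op_iter n.+1 x) - op_iter n (op_iter n x) =
    op_iter n.+1 (op_iter n.+1 x - op_iter n x) +
    (op_iter n.+1 (op_iter n x) - op_iter n (op_iter n x)).
  by rewrite (linB (op_iter_lin n.+1)) addrA subrK.
have /andP[p0 _] := sqrt_iter_bound R n.+1.
have -> : sqrt_iter R n.+2 - sqrt_iter R n.+1 = 2^-1 *
   (sqrt_iter R n.+1 * (sqrt_iter R n.+1 - sqrt_iter R n) +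
    (sqrt_iter R n.+1 - sqrt_iter R n) * sqrt_iter R n) by rewrite /=; field.
rewrite -mulrA ler_pM2l ?invr_gt0 //; apply: le_trans (nrmD _ _) _.
rewrite mulrDl lerD //.
  by apply: le_trans (op_iter_le _ _) _; rewrite -mulrA ler_wpM2l // IH.
apply: le_trans (IH _) _; rewrite -mulrA ler_wpM2l ?op_iter_le //.
by rewrite subr_ge0 sqrt_iter_leS.
Qed.

(** The limit [X] solves [2 X = B + X^2], so [D = 1 - X] squares to [1 - B]. The last clause is how
    covariance reaches [D]: the iterates are polynomials in [B], and [S] is continuous. *)
Lemma operator_root : exists D : H -> H,
  [/\ linear D,
      forall x y, rdot (D x) y = rdot x (D y),
      forall x, D (D x) = x - B x &
      forall S M, linear S -> (forall x, rnorm (S x) <= M * rnorm x) ->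
        (forall x, S (B x) = B (S x)) -> forall x, S (D x) = D (S x)].
Proof.
have [X Xl] : {X : H -> H & forall x, ctends (fun n => op_iter n x) (X x)}.
  apply: (@boolp.choice _ _ (fun x l => ctends (fun n => op_iter n x) l)) => x.
  apply: (@sqrt_iter_dominated _ _ _ (rnorm x)); first exact: nrm_ge0.
  by move=> n; exact: op_iter_diff.
have XL : linear X.
  move=> c x y; apply: (ctends_uniq (Xl _)).
  under [X in ctends X]eq_fun do rewrite op_iter_lin.
  apply: ctendsD (Xl y); apply: (@ctends_lip _ _ _ ( *:%R c) (complex.Re `|c|)) (Xl x).
  by move=> u v; rewrite -scalerBr nrmZc.
have Xcontr x : rnorm (X x) <= rnorm x.
  apply: (rcvg_le (ctends_nrm (Xl x)) (cvg_cst _)) => n /=.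
  apply: le_trans (op_iter_le _ _) _; rewrite ler_piMl ?nrm_ge0 //.
  by have /andP[] := sqrt_iter_bound R n.
have XX x : X (X x) + B x = X x + X x.
  (* With [y_n] for [op_iter n]: [y_n (y_n x) = y_n (y_n x - X x) + y_n (X x)], and the first term
     tends to zero because each [y_n] is a contraction. *)
  have h : ctends (fun n => op_iter n (op_iter n x)) (X (X x)).
    have z : ctends (fun n => op_iter n (op_iter n x - X x)) 0.
      apply: (ctends_le (b := fun n => rnorm (op_iter n x - X x))) (Xl x) => n.
      rewrite subr0; apply: le_trans (op_iter_le _ _) _; rewrite ler_piMl ?nrm_ge0 //.
      by have /andP[] := sqrt_iter_bound R n.
    have := ctendsD z (Xl (X x)); rewrite add0r.
    by under eq_fun do rewrite -(linD (op_iter_lin _)) subrK.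
  have k := ctendsD (ctendsS (Xl x)) (ctendsS (Xl x)).
  apply: (ctends_uniq _ k).
  suff -> : (fun n => op_iter n.+1 x + op_iter n.+1 x) =
      (fun n => op_iter n (op_iter n x) + B x).
    by apply: ctendsD h _; exact: ctends_cst.
  apply/funext => n /=.
  rewrite -scalerDl addrC -rmorphD.
  have -> : 2^-1 + 2^-1 = 1 :> R by lra.
  by rewrite scale1r addrC.
pose D x := x - X x; exists D; split.
- by move=> c x y; rewrite /D XL scalerBr opprD addrACA.
- have sym n : forall x y, rdot (op_iter n x) y = rdot x (op_iter n y).
    elim: n => [|n IH] x y /=; first by rewrite rdot0l rdot0r.
    by rewrite rdotRl rdotRr rdotDl rdotDr Bsym !IH.
  move=> x y; rewrite /D rdotBl rdotBr; congr (_ - _).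
  apply: (cvg_unique _ (ctends_rdot (z := y) (Xl x))) => //.
  have -> : (fun n => rdot (op_iter n x) y) = (fun n => rdot (op_iter n y) x).
    by apply/funext => n; rewrite sym rdotC.
  by rewrite rdotC; exact: ctends_rdot.
- move=> x; rewrite /D (linB XL) opprB addrA.
  have := XX x => /(canRL (addrK _)) ->.
  by rewrite -[LHS]addrA (addrAC (X x + X x)) addrK addrA subrK.
- move=> S M SL SM SB x; rewrite /D (linB SL); congr (_ - _).
  have c n : forall y, S (op_iter n y) = op_iter n (S y).
    elim: n => [|n IH] y /=; first by rewrite (lin0 SL).
    by rewrite (linZ SL) (linD SL) SB !IH.
  apply: (ctends_uniq _ (Xl (S x))).
  under [X in ctends X]eq_fun do rewrite -c.
  by apply: (@ctends_lip _ _ _ S M) (Xl x) => u v; rewrite -(linB SL); exact: SM.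
Qed.

End OperatorRoot.

(** * Contractivity of star representations *)

Section StarRepresentations.
Variables (R : realType) (A : cstarAlgType R).
Implicit Types a b : A.

Let nrm (a : A) : R := complex.Re `|a|.

Let nrmM a b : nrm (cmul a b) <= nrm a * nrm b.
Proof.
by have /lec_Re := cnormM a b; rewrite (norm_realE a) (norm_realE b) -rmorphM.
Qed.

(** The C*-identity gives [|b|^2 = |b^* b| <= |b^*| |b|]; this is applied to [a] and to its star. *)
Lemma cstar_norm a : nrm (cstar a) = nrm a.
Proof.
have le b : nrm b <= nrm (cstar b).
  have h : nrm b ^+ 2 <= nrm (cstar b) * nrm b.
    apply: le_trans (nrmM _ _).
    by rewrite /nrm cnorm_star (norm_realE b) -rmorphXn.
  have [b0|b0] := eqVneq (nrm b) 0; first by rewrite b0 nrm_ge0.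
  by rewrite expr2 ler_pM2r // in h; rewrite lt_neqAle eq_sym b0 nrm_ge0.
by apply/eqP; rewrite eq_le le andbT -{2}(cstarK a) le.
Qed.

Let cmulBl (a b c : A) : cmul (a - b) c = cmul a c - cmul b c.
Proof. by rewrite cmulDl -scaleN1r cmulZl scaleN1r. Qed.

Let cmulBr (a b c : A) : cmul c (a - b) = cmul c a - cmul c b.
Proof. by rewrite cmulDr -scaleN1r cmulZr scaleN1r. Qed.

Let cstarB a b : cstar (a - b) = cstar a - cstar b.
Proof. by rewrite cstarD -scaleN1r cstarZ rmorphN1 scaleN1r. Qed.

Let half : R[i] := (2^-1 : R)%:C.

(** The recursion uses no unit, so it stays inside [A]. *)
Fixpoint quasi_iter (b : A) (n : nat) : A :=
  if n is k.+1 then half *: (b + cmul (quasi_iter b k) (quasi_iter b k)) else 0.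

Let quasi_iter_le b n : nrm b <= 1 -> nrm (quasi_iter b n) <= sqrt_iter R n.
Proof.
move=> b1; elim: n => [|n IH] /=; first by rewrite /nrm normr0.
rewrite /nrm nrmZ ger0_norm ?invr_ge0 // (mulrC _ 2^-1) ler_pM2l ?invr_gt0 //.
apply: le_trans (nrmD _ _) _; rewrite lerD //.
by apply: le_trans (nrmM _ _) _; rewrite expr2 ler_pM ?nrm_ge0.
Qed.

Let quasi_iter_diff b n : nrm b <= 1 ->
  nrm (quasi_iter b n.+1 - quasi_iter b n) <= sqrt_iter R n.+1 - sqrt_iter R n.
Proof.
move=> b1; have y0 : cmul (0 : A) 0 = 0 by rewrite -{1}(scale0r (0 : A)) cmulZl scale0r.
elim: n => [|n IH].
  rewrite /= y0 addr0 !subr0 expr0n addr0 /nrm nrmZ ger0_norm ?invr_ge0 // mul1r.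
  by rewrite ler_piMr ?invr_ge0.
rewrite [quasi_iter b n.+2]/= [in X in _ - X]/= -scalerBr opprD addrACA subrr add0r.
rewrite /nrm nrmZ ger0_norm ?invr_ge0 //.
set u := quasi_iter b n.+1 in IH *; set v := quasi_iter b n in IH *.
rewrite -/u -/v.
have -> : half *: (b + cmul v v) = u by [].
have -> : cmul u u - cmul v v = cmul u (u - v) + cmul (u - v) v.
  by rewrite cmulBl cmulBr addrA subrK.
have /andP[p0 _] := sqrt_iter_bound R n.+1.
have /andP[p1 _] := sqrt_iter_bound R n.
have -> : sqrt_iter R n.+2 - sqrt_iter R n.+1 = 2^-1 *
   (sqrt_iter R n.+1 * (sqrt_iter R n.+1 - sqrt_iter R n) +
    (sqrt_iter R n.+1 - sqrt_iter R n) * sqrt_iter R n) by rewrite /=; field.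
rewrite ler_pM2l ?invr_gt0 //; apply: le_trans (nrmD _ _) _.
by rewrite lerD //; apply: le_trans (nrmM _ _) _; rewrite ler_pM ?nrm_ge0 // quasi_iter_le.
Qed.

(* [1 - y] is a self-adjoint square root of [1 - b] in the unitization. *)
Lemma quasi_root b : cstar b = b -> nrm b <= 1 ->
  exists2 y : A, cstar y = y & y + y = b + cmul y y.
Proof.
move=> bs b1; have [y yl] : exists y, ctends (quasi_iter b) y.
  apply: (@sqrt_iter_dominated _ _ _ 1) => // n; rewrite mulr1.
  exact: quasi_iter_diff.
have cs n : cstar (quasi_iter b n) = quasi_iter b n.
  elim: n => [|n IH] /=; first by rewrite -{1}(scale0r (0 : A)) cstarZ rmorph0 scale0r.
  by rewrite cstarZ cstarD cstarM IH bs; congr (_ *: _); exact: conjc_real.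
exists y.
  apply: (ctends_uniq _ yl).
  have -> : quasi_iter b = (fun n => cstar (quasi_iter b n)).
    by apply/funext => n; rewrite cs.
  apply: (@ctends_lip _ _ _ cstar 1) yl => u v.
  by rewrite mul1r -cstarB [leLHS]cstar_norm.
have h : ctends (fun n => cmul (quasi_iter b n) (quasi_iter b n)) (cmul y y).
  apply: (ctends_le (b := fun n => (1 + nrm y) * nrm (quasi_iter b n - y))) => [n|].
    have -> : cmul (quasi_iter b n) (quasi_iter b n) - cmul y y =
      cmul (quasi_iter b n) (quasi_iter b n - y) + cmul (quasi_iter b n - y) y.
      by rewrite cmulBl cmulBr addrA subrK.
    apply: le_trans (nrmD _ _) _; rewrite mulrDl mul1r lerD //.
      apply: le_trans (nrmM _ _) _; rewrite ler_piMl ?nrm_ge0 //.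
      apply: le_trans (quasi_iter_le n b1) _.
      by have /andP[] := sqrt_iter_bound R n.
    by rewrite mulrC; exact: nrmM.
  by rewrite -(mulr0 (1 + nrm y)); apply: cvgM (cvg_cst _) yl.
apply: (ctends_uniq (ctendsD (ctendsS yl) (ctendsS yl))).
suff -> : (fun n => quasi_iter b n.+1 + quasi_iter b n.+1) =
    (fun n => b + cmul (quasi_iter b n) (quasi_iter b n)).
  by apply: ctendsD h; exact: ctends_cst.
apply/funext => n /=; rewrite -scalerDl -rmorphD.
have -> : 2^-1 + 2^-1 = 1 :> R by lra.
by rewrite scale1r.
Qed.

(* Writing [1 - pi(a* a) = (1 - pi y)^2] with [y] self-adjoint shows that
   [|h|^2 - |pi(a) h|^2] is a square when [|a| <= 1]. *)
Lemma star_representation_contractive (H : hilbertType R) (pi : A -> H -> H) :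
  star_representation pi ->
  forall a h, rnorm (pi a h) <= complex.Re `|a| * rnorm h.
Proof.
move=> [_ piL piM piS].
have pi0 h : pi 0 h = 0.
  by have := piL (-1) 0 0 h; rewrite scaler0 addr0 scaleN1r addNr.
have piD a b h : pi (a + b) h = pi a h + pi b h.
  by have := piL 1 a b h; rewrite !scale1r.
have piZ c a h : pi (c *: a) h = c *: pi a h.
  by have := piL c a 0 h; rewrite addr0 pi0 addr0.
have piA a x y : rdot (pi a x) y = rdot x (pi (cstar a) y) by rewrite /rdot piS.
have contr a h : nrm a <= 1 -> rnorm (pi a h) <= rnorm h.
  move=> a1; have [|| y ys yy] := @quasi_root (cmul (cstar a) a).
  - by rewrite cstarM cstarK.
  - apply: le_trans (nrmM _ _) _; rewrite cstar_norm -expr2.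
    by rewrite expr_le1 ?nrm_ge0.
  rewrite -(ler_pXn2r (n := 2)) ?nnegrE ?nrm_ge0 // !rnormE -subr_ge0.
  have := rdot_ge0 (h - pi y h); congr (0 <= _).
  rewrite rdotBl !rdotBr (piA y h (pi y h)) (piA a h (pi a h)) ys -!piM.
  have : rdot h (pi (y + y) h) = rdot h (pi (cmul (cstar a) a + cmul y y) h) by rewrite yy.
  rewrite !piD !rdotDr (rdotC (pi y h) h); lra.
move=> a h; rewrite -/(nrm a).
have [a0|a0] := eqVneq (nrm a) 0.
  by rewrite a0 mul0r (nrm_eq0 a0) pi0 /rnorm normr0.
have ap : 0 < nrm a by rewrite lt_neqAle eq_sym a0 nrm_ge0.
have := contr ((nrm a)^-1%:C *: a) h; rewrite {1}/nrm nrmZ -/(nrm a).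
rewrite ger0_norm ?invr_ge0 ?nrm_ge0 // mulVf // => /(_ (lexx _)).
by rewrite piZ /rnorm nrmZ ger0_norm ?invr_ge0 ?nrm_ge0 // ler_pdivrMl.
Qed.

End StarRepresentations.

(** * Hilbert sums *)

Section RealSeries.
Variable R : realType.
Implicit Types u v : nat -> R.

Lemma nonneg_series_cvg u M : (forall n, 0 <= u n) ->
  (forall n, \sum_(k < n) u k <= M) -> cvgn (series u) /\ limn (series u) <= M.
Proof.
move=> u0 uM; have c : cvgn (series u).
  apply: nondecreasing_is_cvgn; first exact: nondecreasing_series.
  by exists M => _ [n _ <-]; rewrite /series /= big_mkord.
split=> //; apply: limr_le => //; apply: nearW => n.
by rewrite /series /= big_mkord.
Qed.

Lemma nonneg_series_ge u n : (forall n, 0 <= u n) -> cvgn (series u) ->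
  \sum_(k < n) u k <= limn (series u).
Proof.
move=> u0 c; have := nondecreasing_cvgn_le (nondecreasing_series _) c n.
by rewrite /series /= big_mkord; apply.
Qed.

Lemma limn_series_finite u n : (forall k, (n <= k)%N -> u k = 0) ->
  cvgn (series u) /\ limn (series u) = \sum_(k < n) u k.
Proof.
move=> u0; have h : series u @ \oo --> \sum_(k < n) u k.
  apply: cvg_near_cst.
  exists n => // m /= nm; rewrite /series /= -(big_mkord xpredT u).
  rewrite (big_cat_nat _ (n := n)) //= [X in _ + X]big1_seq ?addr0 // => k.
  by rewrite mem_index_iota => /andP[_ /andP[nk _]]; rewrite u0.
by split; [apply/cvg_ex; exists (\sum_(k < n) u k) | exact: cvg_lim h].
Qed.

Lemma limn_seriesDZ a u v : cvgn (series u) -> cvgn (series v) ->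
  cvgn (series (fun n => a * u n + v n)) /\
  limn (series (fun n => a * u n + v n)) = a * limn (series u) + limn (series v).
Proof.
move=> cu cv.
have e : series (fun n => a * u n + v n) = (fun n => a * series u n + series v n).
  by apply/funext => n; rewrite /series /= mulr_sumr -big_split.
have h : (fun n => a * series u n + series v n) @ \oo -->
    a * limn (series u) + limn (series v).
  by apply: cvgD cv; apply: cvgM cu; exact: cvg_cst.
rewrite e; split; last exact: cvg_lim h.
by apply/cvg_ex; exists (a * limn (series u) + limn (series v)).
Qed.

(** Taking [a = q], [b = - r] gives [q (p q - r^2) >= 0]. If [q = 0], the form at [a = 1] is affine
    in [b] and nonnegative, so [r = 0]. *)
Lemma quadratic_form_le (p q r : R) :
  (forall a b : R, 0 <= a ^+ 2 * p + 2 * a * b * r + b ^+ 2 * q) ->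
  r ^+ 2 <= p * q.
Proof.
move=> h; have q0 : 0 <= q.
  by have := h 0 1; congr (0 <= _); ring.
have [qz|qz] := eqVneq q 0.
  rewrite qz mulr0; have [->|rz] := eqVneq r 0; first by rewrite expr0n.
  have := h 1 (- (p + 1) / (2 * r)); rewrite qz.
  have -> : 1 ^+ 2 * p + 2 * 1 * (- (p + 1) / (2 * r)) * r +
     (- (p + 1) / (2 * r)) ^+ 2 * 0 = -1 by field.
  by rewrite lerNr oppr0 ler10.
have qp : 0 < q by rewrite lt_neqAle eq_sym qz.
rewrite -subr_ge0 -(pmulr_rge0 _ qp); have := h q (- r); congr (0 <= _); ring.
Qed.

End RealSeries.

(* Cutting out the terms by orthogonality to arbitrary sets [N n] yields
   closed subspaces without any proof obligation on [N]. *)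
Section SquareSummable.
Variables (R : realType) (H : hilbertType R) (N : nat -> set H).

Definition l2_pred : {pred nat -> H} :=
  fun f => `[< (forall n, orthocompl (N n) (f n)) /\
              cvgn (series (fun n => rdot (f n) (f n))) >].

Lemma l2_predP (f : nat -> H) M : (forall n, orthocompl (N n) (f n)) ->
  (forall n, \sum_(k < n) rdot (f k) (f k) <= M) -> f \in l2_pred.
Proof.
move=> fN fM; apply/asboolP; split=> //.
by have [] := nonneg_series_cvg (fun n => rdot_ge0 (f n)) fM.
Qed.

Lemma l2_pred_submod : submod_closed l2_pred.
Proof.
split=> [|c f g /asboolP[fN fs] /asboolP[gN gs]].
  apply/asboolP; split=> [n x _|].
    exact: inner0r.
  have [] // := @limn_series_finite R (fun=> rdot (0 : H) 0) 0.
  by move=> k _; exact: rdot0l.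
have c0 : 0 <= 2 * complex.Re `|c| ^+ 2 by rewrite mulr_ge0 // sqr_ge0.
apply: (@l2_predP _ (2 * complex.Re `|c| ^+ 2 * limn (series (fun n => rdot (f n) (f n)))
  + 2 * limn (series (fun n => rdot (g n) (g n))))) => [n x Nx|n].
  by rewrite innerDr innerZr fN // gN // mulr0 addr0.
apply: (@le_trans _ _ (\sum_(k < n) (2 * complex.Re `|c| ^+ 2 * rdot (f k) (f k) +
    2 * rdot (g k) (g k)))).
  apply: ler_sum => k _; rewrite -!rnormE -mulrA -exprMn -nrmZc.
  have := nrmD (c *: f k) (g k); rewrite -[(c *: f + g) k]/(c *: f k + g k).
  rewrite -/(rnorm (c *: f k)) -/(rnorm (g k)) -/(rnorm (c *: f k + g k)).
  move: (nrm_ge0 (c *: f k + g k)); rewrite -/(rnorm (c *: f k + g k)).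
  move: (rnorm _) (rnorm (c *: f k)) (rnorm (g k)) => p q r p0 pqr.
  have := sqr_ge0 (q - r); nra.
rewrite big_split /= -!mulr_sumr lerD // ler_wpM2l // nonneg_series_ge //.
  by move=> k; exact: rdot_ge0.
by move=> k; exact: rdot_ge0.
Qed.

HB.instance Definition _ := GRing.isSubmodClosed.Build R[i] (nat -> H) l2_pred l2_pred_submod.

Record l2seq := L2Seq { l2fun :> nat -> H; l2funP : l2fun \in l2_pred }.

HB.instance Definition _ := [isSub for l2fun].
HB.instance Definition _ := [Choice of l2seq by <:].
HB.instance Definition _ := [SubChoice_isSubLmodule of l2seq by <:].

Implicit Types f g h : l2seq.

Lemma l2seq_eq f g : (forall n, f n = g n) -> f = g.
Proof. by move=> fg; apply/val_inj/funext. Qed.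

Lemma l2funD f g n : (f + g) n = f n + g n. Proof. by []. Qed.
Lemma l2funN f n : (- f) n = - f n. Proof. by []. Qed.
Lemma l2funZ (c : R[i]) f n : (c *: f) n = c *: f n. Proof. by []. Qed.

End SquareSummable.

Lemma rcvg_sum (R : realType) n (a : nat -> nat -> R) (l : nat -> R) :
  (forall k, a k @ \oo --> l k) ->
  (fun m => \sum_(k < n) a k m) @ \oo --> \sum_(k < n) l k.
Proof.
move=> al; elim: n => [|n IH].
  by rewrite big_ord0; under eq_fun do rewrite big_ord0; exact: cvg_cst.
rewrite big_ord_recr /=; under eq_fun do rewrite big_ord_recr /=.
exact: cvgD.
Qed.

(** Completeness is a statement on filters. Centres of balls of radius [harmonic n] belonging to [F]
    form a sequence, and since any two of these balls meet, [2 * harmonic n] is a Cauchy modulus for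
    it. *)
Lemma seq_complete (R : realType) (V : normedModType R[i]) :
  (forall u : nat -> V, (forall n m, (n <= m)%N ->
     complex.Re `|u n - u m| <= 2 * harmonic n) -> exists l, ctends u l) ->
  forall F : set_system V, ProperFilter F -> cauchy F -> cvg F.
Proof.
move=> Vc F FF /cauchyP Fc.
have hp n : (0 : R[i]) < (harmonic n)%:C by rewrite ltcR harmonic_gt0.
have [u uF] : {u : nat -> V & forall n, F (ball (u n) (harmonic n : R)%:C)}.
  apply: (@boolp.choice _ _ (fun n x => F (ball x (harmonic n : R)%:C))) => n.
  exact: Fc.
have uB n x : ball (u n) (harmonic n : R)%:C x -> complex.Re `|u n - x| < harmonic n.
  by rewrite -ball_normE => /ltc_Re.
have [|l ul] := Vc u.
  move=> n m nm; have [x []] := @filter_ex _ F _ _ (filterI (uF n) (uF m)).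
  move=> /uB h1 /uB h2; apply: le_trans (nrm_split _ _ x) _.
  have : harmonic m <= harmonic n :> R by rewrite /= lef_pV2 ?posrE // ler_nat.
  move: (harmonic m) (harmonic n) h1 h2 => a b; lra.
apply/cvg_ex; exists l; apply/cvgrPdist_lt => e e0.
have e2 : 0 < complex.Re e / 2.
  by have /ltc_Re /= h := e0; lra.
have /cvgr_lt/(_ _ e2) h1 := @cvg_harmonic R.
have /cvgr_lt/(_ _ e2) h2 := ul.
have [n [nh nu]] := @filter_ex _ \oo _ _ (filterI h1 h2).
apply: filterS (uF n) => x /uB h3.
rewrite norm_realE -[e]RRe_real ?gtr0_real // ltcR.
apply: le_lt_trans (nrm_split _ _ (u n)) _.
rewrite (nrmB l) (nrmB x).
by rewrite [ltRHS]splitr ltrD // (lt_trans h3).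
Qed.

Section L2Hilbert.
Variables (R : realType) (H : hilbertType R) (N : nat -> set H).
Local Notation K := (l2seq N).
Implicit Types f g h : K.

Definition sdot f g : R := limn (series (fun n => rdot (f n) (g n))).

Lemma l2_cvg f : cvgn (series (fun n => rdot (f n) (f n))).
Proof. by have /asboolP[] := l2funP f. Qed.

Lemma l2_orth f n : orthocompl (N n) (f n).
Proof. by have /asboolP[] := l2funP f. Qed.

(** Polarization: a quarter of [|f + g|^2 - |f - g|^2]. *)
Lemma l2_cvg_rdot f g : cvgn (series (fun n => rdot (f n) (g n))).
Proof.
have -> : (fun n => rdot (f n) (g n)) = (fun n =>
    4^-1 * rdot ((f + g) n) ((f + g) n) +
    (- 4^-1 * rdot ((f - g) n) ((f - g) n) + 0)).
  apply/funext => n; rewrite l2funD l2funD l2funN.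
  rewrite !(rdotBl, rdotBr, rdotDl, rdotDr) (rdotC (g n) (f n)).
  by field.
have [h _] := @limn_series_finite R (fun=> 0) 0 (fun=> fun=> erefl).
have [h1 _] := limn_seriesDZ (- 4^-1) (@l2_cvg (f - g)) h.
by have [] := limn_seriesDZ 4^-1 (@l2_cvg (f + g)) h1.
Qed.

Lemma sdotC f g : sdot f g = sdot g f.
Proof. by rewrite /sdot; congr (limn (series _)); apply/funext => n; rewrite rdotC. Qed.

Lemma sdotDl f g h : sdot (f + g) h = sdot f h + sdot g h.
Proof.
have [_] := limn_seriesDZ 1 (@l2_cvg_rdot f h) (@l2_cvg_rdot g h).
rewrite mul1r => <-; congr (limn (series _)); apply/funext => n.
by rewrite mul1r l2funD rdotDl.
Qed.

Lemma sdotRl (a : R) f h : sdot (a%:C *: f) h = a * sdot f h.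
Proof.
have [h0 s0] := @limn_series_finite R (fun=> 0) 0 (fun=> fun=> erefl).
have [_] := limn_seriesDZ a (@l2_cvg_rdot f h) h0.
rewrite s0 big_ord0 addr0 => <-; congr (limn (series _)); apply/funext => n.
by rewrite addr0 l2funZ rdotRl.
Qed.

Lemma sdotZ (c : R[i]) f h : sdot (c *: f) h = sdot f ((c^*)%C *: h).
Proof.
rewrite /sdot; congr (limn (series _)); apply/funext => n.
by rewrite !l2funZ rdotZ.
Qed.

Lemma sdotZl (c : R[i]) f h : sdot (c *: f) h =
  complex.Re c * sdot f h - complex.Im c * sdot f ('i%C *: h).
Proof.
have iE : sdot ('i%C *: f) h = - sdot f ('i%C *: h).
  have -> : - sdot f ('i%C *: h) = sdot f ((-1 : R)%:C *: ('i%C *: h)).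
    by rewrite [RHS]sdotC sdotRl mulN1r sdotC.
  rewrite sdotZ scalerA; congr (sdot f (_ *: h)).
  by rewrite rmorphN1 mulN1r; congr (_ +i* _); rewrite oppr0.
rewrite {1}[c]complexE scalerDl sdotDl ['i%C * _]mulrC -scalerA.
by rewrite (sdotRl (complex.Re c)) (sdotRl (complex.Im c)) iE mulrN.
Qed.

Lemma sdot_ge0 f : 0 <= sdot f f.
Proof.
apply: le_trans (nonneg_series_ge 0 _ (@l2_cvg f)); first by rewrite big_ord0.
by move=> n; exact: rdot_ge0.
Qed.

Lemma sdot_partial f n : \sum_(k < n) rdot (f k) (f k) <= sdot f f.
Proof. by apply: (nonneg_series_ge n _ (@l2_cvg f)) => k; exact: rdot_ge0. Qed.

Lemma sdot_le f M : (forall n, \sum_(k < n) rdot (f k) (f k) <= M) -> sdot f f <= M.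
Proof.
by move=> fM; have [] := nonneg_series_cvg (fun n => rdot_ge0 (f n)) fM.
Qed.

Lemma sdot_eq0 f : sdot f f = 0 -> f = 0.
Proof.
move=> f0; apply/l2seq_eq => n; apply: rdot_eq0; apply/eqP.
rewrite eq_le rdot_ge0 andbT -f0; apply: le_trans (@sdot_partial f n.+1).
rewrite big_ord_recr /= lerDr; apply: sumr_ge0 => k _; exact: rdot_ge0.
Qed.

Definition l2norm_seq f : R[i] := (Num.sqrt (sdot f f))%:C.

Lemma sdot_cauchy_schwarz f g : sdot f g <= Num.sqrt (sdot f f) * Num.sqrt (sdot g g).
Proof.
rewrite -sqrtrM ?sdot_ge0 //; apply: le_trans (ler_norm _) _.
rewrite -sqrtr_sqr ler_wsqrtr //; apply: quadratic_form_le => a b.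
have := sdot_ge0 (a%:C *: f + b%:C *: g); congr (0 <= _).
rewrite sdotDl sdotRl sdotRl (sdotC f) (sdotC g) !sdotDl !sdotRl (sdotC g f); ring.
Qed.

Lemma l2norm_seqD f g : l2norm_seq (f + g) <= l2norm_seq f + l2norm_seq g.
Proof.
rewrite /l2norm_seq -rmorphD lecR.
rewrite -(ler_pXn2r (n := 2)) ?nnegrE ?addr_ge0 ?sqrtr_ge0 //.
rewrite sqr_sqrtr ?sdot_ge0 // sqrrD !sqr_sqrtr ?sdot_ge0 //.
rewrite sdotDl !(sdotC _ (f + g)) !sdotDl (sdotC g f).
have := sdot_cauchy_schwarz f g; lra.
Qed.

Lemma sdotZZ (c : R[i]) f : sdot (c *: f) (c *: f) = complex.Re `|c| ^+ 2 * sdot f f.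
Proof.
rewrite sdotZ scalerA sdotC -sdotRl; congr (sdot (_ *: f) f).
by rewrite mulrC -sqr_normc (norm_realE (c : R[i]^o)) rmorphXn.
Qed.

Lemma l2norm_seqZ (c : R[i]) f : l2norm_seq (c *: f) = `|c| * l2norm_seq f.
Proof.
rewrite /l2norm_seq sdotZZ sqrtrM ?sqr_ge0 // sqrtr_sqr ger0_norm ?nrm_ge0 //.
  by rewrite [in RHS](norm_realE (c : R[i]^o)) -rmorphM.
exact: (nrm_ge0 (c : R[i]^o)).
Qed.

Lemma l2norm_seq_eq0 f : l2norm_seq f = 0 -> f = 0.
Proof.
move=> /(congr1 (@complex.Re _)) /= /eqP; rewrite sqrtr_eq0 => f0.
by apply/sdot_eq0/eqP; rewrite eq_le f0 sdot_ge0.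
Qed.

HB.instance Definition _ := Lmodule_isNormed.Build R[i] K
  l2norm_seqD l2norm_seqZ l2norm_seq_eq0.

Lemma l2_normE f : complex.Re `|f| = Num.sqrt (sdot f f).
Proof. by []. Qed.

Lemma l2_coord_le f n : complex.Re `|f n| <= complex.Re `|f|.
Proof.
rewrite l2_normE -(ler_pXn2r (n := 2)) ?nnegrE ?sqrtr_ge0 ?nrm_ge0 //.
rewrite [leLHS]rnormE sqr_sqrtr ?sdot_ge0 //.
apply: le_trans (@sdot_partial f n.+1).
by rewrite big_ord_recr /= lerDr; apply: sumr_ge0 => k _; exact: rdot_ge0.
Qed.

(** The limit [g] is taken coordinatewise. Finite partial sums of [|u n - g|^2] inherit the bound
    [(2 * harmonic n)^2], and this puts [u n - g], hence [g], in the space. *)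
Lemma l2seq_seq_complete (u : nat -> K) :
  (forall n m, (n <= m)%N -> complex.Re `|u n - u m| <= 2 * harmonic n) ->
  exists l, ctends u l.
Proof.
move=> uc.
have b0 : (fun n => 2 * harmonic n) @ \oo --> (0 : R).
  by rewrite -(mulr0 2); apply: cvgM (cvg_cst _) _; exact: cvg_harmonic.
have [g gl] : {g : nat -> H & forall k, ctends (fun n => u n k) (g k)}.
  apply: (@boolp.choice _ _ (fun k l => ctends (fun n => u n k) l)) => k.
  apply: (complete_ctends b0) => n m /uc.
  by apply: le_trans; exact: (l2_coord_le (u n - u m) k).
have gsum n K0 : \sum_(k < K0) rdot (u n k - g k) (u n k - g k) <= (2 * harmonic n) ^+ 2.
  have c : (fun m => \sum_(k < K0) rdot (u n k - u (m + n)%N k) (u n k - u (m + n)%N k)) @ \oo -->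
      \sum_(k < K0) rdot (u n k - g k) (u n k - g k).
    apply: (rcvg_sum (a := fun k m => rdot (u n k - u (m + n)%N k) (u n k - u (m + n)%N k))
      (l := fun k => rdot (u n k - g k) (u n k - g k))) => k.
    have h : ctends (fun m => u n k - u (m + n)%N k) (u n k - g k).
      have s := gl k; rewrite /ctends -(cvg_shiftn n) in s.
      apply: (ctends_le _ s) => m.
      by rewrite opprB addrC addrA subrK nrmB.
    have -> : (fun m => rdot (u n k - u (m + n)%N k) (u n k - u (m + n)%N k)) =
      (fun m => rnorm (u n k - u (m + n)%N k) * rnorm (u n k - u (m + n)%N k)).
      by apply/funext => m; rewrite -expr2 rnormE.
    by rewrite -rnormE expr2; apply: cvgM; exact: ctends_nrm.
  have h0 : 0 <= harmonic n :> R by rewrite ltW ?harmonic_gt0.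
  apply: (rcvg_le c (cvg_cst _)) => m.
  apply: le_trans (sdot_partial (u n - u (m + n)%N) K0) _.
  rewrite -[leLHS]sqr_sqrtr ?sdot_ge0 // ler_pXn2r ?nnegrE ?sqrtr_ge0 ?mulr_ge0 //.
  by apply: uc; rewrite leq_addl.
have gN k : orthocompl (N k) (g k).
  move=> x Nx; apply: inner_eq0.
    rewrite rdotC; apply: (cvg_unique _ (ctends_rdot (z := x) (gl k))) => //.
    have -> : (fun n => rdot (u n k) x) = fun=> 0.
      by apply/funext => n; rewrite rdotC /rdot l2_orth.
    exact: cvg_cst.
  rewrite -[X in X *: _]conjcK -rdotZ rdotC.
  apply: (cvg_unique _ (ctends_rdot (gl k))) => //.
  have -> : (fun n => rdot (u n k) (('i^*)%C *: x)) = fun=> 0.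
    by apply/funext => n; rewrite rdotC rdotZ conjcK -Im_inner l2_orth.
  exact: cvg_cst.
have dP n : (fun k => u n k - g k) \in l2_pred N.
  apply: l2_predP (gsum n) => k x Nx.
  by rewrite innerDr innerNr l2_orth // gN // subr0.
have gP : g \in l2_pred N.
  have -> : g = (u 0 : nat -> H) - (fun k => u 0 k - g k).
    by apply/funext => k; rewrite /= !fctE opprB addrC subrK.
  by apply: rpredB (dP 0); exact: l2funP.
exists (L2Seq gP); apply: ctends_le b0 => n.
have h0 : 0 <= harmonic n :> R by rewrite ltW ?harmonic_gt0.
rewrite l2_normE -(ler_pXn2r (n := 2)) ?nnegrE ?sqrtr_ge0 ?mulr_ge0 //.
by rewrite sqr_sqrtr ?sdot_ge0 //; apply: sdot_le => k; exact: gsum.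
Qed.

HB.instance Definition _ := Uniform_isComplete.Build K (seq_complete l2seq_seq_complete).

(** Conjugate linearity in the second argument forces the imaginary part to be the real part of the
    pairing with [i g]. *)
Definition l2inner f g : R[i] := sdot f g +i* sdot f ('i%C *: g).

Lemma l2inner_linearl (g : K) : GRing.linear_for *%R (l2inner^~ g).
Proof.
move=> c f f'; rewrite /l2inner !sdotDl !sdotZl scalerA.
have -> : sdot f (('i * 'i)%C *: g) = - sdot f g.
  rewrite -expr2 sqr_i scaleN1r -scaleN1r.
  by have := sdotRl (-1) g f; rewrite rmorphN1 mulN1r !(sdotC f).
case: c => a b /=; congr (_ +i* _); ring.
Qed.

Lemma l2inner_herm f g : l2inner f g = (-1) ^+ false * Num.conj (l2inner g f).
Proof.
rewrite expr0 mul1r /l2inner; congr (_ +i* _); first exact: sdotC.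
have -> : - sdot g ('i%C *: f) = sdot ((-1 : R)%:C *: ('i%C *: f)) g.
  by rewrite sdotRl mulN1r sdotC.
rewrite scalerA sdotZ; congr (sdot f (_ *: g)).
by rewrite rmorphN1 mulN1r; congr (_ +i* _); rewrite ?oppr0 ?opprK.
Qed.

Lemma l2inner_linearr (f : K) : GRing.linear_for (Num.conj \; *%R) (l2inner f).
Proof.
move=> c g g'; rewrite l2inner_herm expr0 mul1r (l2inner_linearl f c g g').
rewrite rmorphD rmorphM /= (l2inner_herm f g) (l2inner_herm f g') !expr0 !mul1r.
by [].
Qed.

HB.instance Definition _ := bilinear_isBilinear.Build R[i] K K R[i] *%R
  (Num.conj \; *%R) l2inner (conj l2inner_linearl l2inner_linearr).

HB.instance Definition _ :=
  isHermitianSesquilinear.Build R[i] K false Num.conj l2inner l2inner_herm.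

Lemma l2innerE f : l2inner f f = (sdot f f)%:C.
Proof.
rewrite /l2inner; congr (_ +i* _).
have : sdot f ('i%C *: f) = - sdot f ('i%C *: f); last by lra.
have -> : - sdot f ('i%C *: f) = sdot ((-1 : R)%:C *: ('i%C *: f)) f.
  by rewrite sdotRl mulN1r sdotC.
rewrite scalerA sdotZ; congr (sdot f (_ *: f)).
by rewrite rmorphN1 mulN1r; congr (_ +i* _); rewrite ?oppr0 ?opprK.
Qed.

Lemma l2inner_gt0 f : f != 0 -> 0 < l2inner f f.
Proof.
move=> f0; rewrite l2innerE ltcR lt_neqAle sdot_ge0 andbT eq_sym.
by apply: contra f0 => /eqP/sdot_eq0 ->.
Qed.

HB.instance Definition _ := isDotProduct.Build R[i] K l2inner l2inner_gt0.

Lemma l2_norm_inner f : `|f| ^+ 2 = l2inner f f.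
Proof.
by rewrite l2innerE (norm_realE f) l2_normE -rmorphXn /= sqr_sqrtr ?sdot_ge0.
Qed.

HB.instance Definition _ := isHilbert.Build R K l2_norm_inner.

End L2Hilbert.

Lemma l2_rdotE (R : realType) (H : hilbertType R) (N : nat -> set H) (f g : l2seq N) :
  rdot f g = limn (series (fun n => rdot (f n) (g n))).
Proof. by []. Qed.

(** * The one-step dilation *)

Section Pairs.
Variables (R : realType) (H : hilbertType R).

(* The terms of index at least [2] are forced to vanish: this is [H (+) H]. *)
Definition pair_constraint (n : nat) : set H := if n is _.+2 then setT else set0.

Local Notation H2 := (l2seq pair_constraint).

Lemma pair_tail (p : H2) n : p n.+2 = 0.
Proof.
apply: rdot_eq0; rewrite /rdot.
by have -> := @l2_orth R H pair_constraint p n.+2 (p n.+2) I.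
Qed.

Lemma pair_rdot (p q : H2) : rdot p q = rdot (p 0%N) (q 0%N) + rdot (p 1%N) (q 1%N).
Proof.
have t k : (2 <= k)%N -> rdot (p k) (q k) = 0.
  by case: k => [|[|n]] // _; rewrite pair_tail rdot0l.
have [_ e] := limn_series_finite (u := fun n => rdot (p n) (q n)) t.
by rewrite l2_rdotE e big_ord_recl big_ord1.
Qed.

Definition pair_seq (x y : H) (n : nat) : H :=
  match n with 0 => x | 1 => y | _ => 0 end.

Lemma pair_seqP x y : pair_seq x y \in l2_pred pair_constraint.
Proof.
apply/asboolP; split; first by move=> [|[|n]] z //= _; exact: inner0r.
have [] // := @limn_series_finite R (fun n => rdot (pair_seq x y n) (pair_seq x y n)) 2.
by move=> [|[|n]] // _; exact: rdot0l.
Qed.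

Definition hpair x y : H2 := L2Seq (pair_seqP x y).

Lemma hpair_eq (p q : H2) : p 0%N = q 0%N -> p 1%N = q 1%N -> p = q.
Proof. by move=> h0 h1; apply: l2seq_eq => -[|[|n]] //; rewrite !pair_tail. Qed.

Lemma hpair_lin (c : R[i]) x y x' y' :
  hpair (c *: x + x') (c *: y + y') = c *: hpair x y + hpair x' y'.
Proof. exact: hpair_eq. Qed.

End Pairs.

Section DefectShift.
Variables (R : realType) (H : hilbertType R) (T D : H -> H).
Hypothesis TL : linear T.
Hypothesis DL : linear D.
Hypothesis Dsym : forall x y, rdot (D x) y = rdot x (D y).
Hypothesis TD : forall x y, rdot (T x) (T y) + rdot (D x) (D y) = rdot x y.

(* The orthogonal complement of the kernel of the self-adjoint [D] is the
   closure of its range. *)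
Definition defect_constraint (n : nat) : set H :=
  if n is _.+1 then [set x | D x = 0] else set0.

Local Notation K := (l2seq defect_constraint).

Lemma defect_range y n : orthocompl (defect_constraint n.+1) (D y).
Proof.
move=> x Dx; rewrite -(rdot_adj_inner DL Dsym).
by rewrite [D x]Dx innerC inner0r rmorph0.
Qed.

(** Schäffer's form of the isometric dilation of [T]. *)
Definition shift_seq (f : K) (n : nat) : H :=
  match n with 0 => T (f 0%N) | 1 => D (f 0%N) | k.+2 => f k.+1 end.

(** One more term on the left absorbs [T^* T + D^2 = 1] exactly, so both inequalities behind the
    isometry follow from finite sums. *)
Lemma shift_seq_sum (f : K) n :
  \sum_(k < n.+2) rdot (shift_seq f k) (shift_seq f k) =
  \sum_(k < n.+1) rdot (f k) (f k).
Proof.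
by rewrite 2!big_ord_recl [RHS]big_ord_recl addrA TD.
Qed.

Lemma shift_seq_le (f : K) n :
  \sum_(k < n) rdot (shift_seq f k) (shift_seq f k) <= rdot f f.
Proof.
apply: (@le_trans _ _ (\sum_(k < n.+2) rdot (shift_seq f k) (shift_seq f k))).
  by rewrite !big_ord_recr /= -addrA lerDl addr_ge0 ?rdot_ge0.
by rewrite shift_seq_sum; exact: sdot_partial.
Qed.

Lemma shift_seqP (f : K) : shift_seq f \in l2_pred defect_constraint.
Proof.
apply: l2_predP (shift_seq_le f) => -[|[|n]] //=; first exact: (@defect_range _ 0).
exact: (@l2_orth _ _ _ f n.+1).
Qed.

Definition defect_shift (f : K) : K := L2Seq (shift_seqP f).

Lemma defect_shift_lin : linear defect_shift.
Proof. by move=> c f g; apply: l2seq_eq => -[|[|n]] //; [exact: TL|exact: DL]. Qed.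

Lemma defect_shift_iso f : rnorm (defect_shift f) = rnorm f.
Proof.
apply/eqP; rewrite -(eqrXn2 (n := 2)) ?nrm_ge0 // !rnormE eq_le.
apply/andP; split; first by apply: sdot_le; exact: shift_seq_le.
apply: sdot_le => n; apply: (@le_trans _ _ (\sum_(k < n.+1) rdot (f k) (f k))).
  by rewrite big_ord_recr /= lerDl rdot_ge0.
by rewrite -shift_seq_sum; exact: (@sdot_partial _ _ _ (defect_shift f) n.+2).
Qed.

Definition embed_seq (h : H) (n : nat) : H := if n is 0 then h else 0.

Lemma embed_seqP h : embed_seq h \in l2_pred defect_constraint.
Proof.
apply/asboolP; split; first by move=> [|n] z //= _; exact: inner0r.
have [] // := @limn_series_finite R (fun n => rdot (embed_seq h n) (embed_seq h n)) 1.
by move=> [|n] // _; exact: rdot0l.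
Qed.

Definition defect_embed h : K := L2Seq (embed_seqP h).

Lemma defect_embed_lin : linear defect_embed.
Proof.
by move=> c x y; apply: l2seq_eq => -[|n] //; rewrite l2funD l2funZ /= scaler0 addr0.
Qed.

(** The adjoint of the embedding is the zeroth coordinate, so co-extension says that an operator on
    the sum acts on the zeroth coordinate as the given operator on [H]. *)
Lemma rdot_defect_embed (f : K) h : rdot f (defect_embed h) = rdot (f 0%N) h.
Proof.
have t k : (1 <= k)%N -> rdot (f k) (defect_embed h k) = 0.
  by case: k => [|n] // _; exact: rdot0r.
have [_ e] := limn_series_finite (u := fun n => rdot (f n) (defect_embed h n)) t.
by rewrite l2_rdotE e big_ord1.
Qed.

End DefectShift.

(** * Lifting a commuting contraction *)

Section CommutantLifting.
Variables (R : realType) (H : hilbertType R) (T1 D1 T2 D2 : H -> H).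
Hypotheses (T1L : linear T1) (D1L : linear D1) (T2L : linear T2) (D2L : linear D2).
Hypothesis D1sym : forall x y, rdot (D1 x) y = rdot x (D1 y).
Hypothesis TD1 : forall x y, rdot (T1 x) (T1 y) + rdot (D1 x) (D1 y) = rdot x y.
Hypothesis TD2 : forall x y, rdot (T2 x) (T2 y) + rdot (D2 x) (D2 y) = rdot x y.
Hypothesis T12 : forall x, T1 (T2 x) = T2 (T1 x).

Local Notation K := (l2seq (defect_constraint D1)).
Local Notation H2 := (l2seq (@pair_constraint R H)).
Local Notation V := (defect_shift D1L D1sym TD1).

Definition defect_src x : H2 := hpair (D2 (T1 x)) (D1 x).
Definition defect_tgt x : H2 := hpair (D1 (T2 x)) (D2 x).

Lemma defect_src_lin : linear defect_src.
Proof. by move=> c x y; rewrite /defect_src T1L D2L D1L hpair_lin. Qed.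

Lemma defect_tgt_lin : linear defect_tgt.
Proof. by move=> c x y; rewrite /defect_tgt T2L D2L D1L hpair_lin. Qed.

(** Both sides equal [rdot x y - rdot (T1 (T2 x)) (T1 (T2 y))]. *)
Lemma defect_src_tgt x y :
  rdot (defect_src x) (defect_src y) = rdot (defect_tgt x) (defect_tgt y).
Proof.
rewrite !pair_rdot /=.
have := TD2 (T1 x) (T1 y); have := TD1 (T2 x) (T2 y).
have := TD1 x y; have := TD2 x y; rewrite !T12; lra.
Qed.

Variable w : H2 -> H2.
Hypothesis wL : linear w.
Hypothesis w_src : forall x, w (defect_src x) = defect_tgt x.
Hypothesis w_range : forall y v, (forall x, rdot (defect_tgt x) v = 0) -> rdot (w y) v = 0.
Hypothesis w_le : forall y, rnorm (w y) <= rnorm y.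
Hypothesis w_iso : forall y, (forall v, (forall x, rdot (defect_src x) v = 0) ->
  rdot y v = 0) -> rnorm (w y) = rnorm y.

(* The lifting of [T2] is the input-output map of the linear system with
   transfer operator [w]: state [lift_state f n], input [f n.+1], output
   [lift_output f n]. *)
Fixpoint lift_state (f : nat -> H) (n : nat) : H :=
  if n is k.+1 then w (hpair (lift_state f k) (f k.+1)) 1%N else D2 (f 0%N).

Definition lift_output (f : nat -> H) (n : nat) : H := w (hpair (lift_state f n) (f n.+1)) 0%N.

Definition lift_seq (f : nat -> H) (n : nat) : H :=
  if n is k.+1 then lift_output f k else T2 (f 0%N).

Lemma step_le x y :
  rdot (w (hpair x y) 0%N) (w (hpair x y) 0%N) + rdot (w (hpair x y) 1%N) (w (hpair x y) 1%N)
  <= rdot x x + rdot y y.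
Proof.
have := w_le (hpair x y); rewrite -(ler_pXn2r (n := 2)) ?nnegrE ?nrm_ge0 //.
by rewrite !rnormE !pair_rdot.
Qed.

(** Energy balance: as [w] is a contraction, output plus stored energy never exceeds initial plus
    input energy. *)
Lemma lift_state_energy f n :
  \sum_(k < n) rdot (lift_output f k) (lift_output f k) + rdot (lift_state f n) (lift_state f n) <=
  rdot (D2 (f 0%N)) (D2 (f 0%N)) + \sum_(k < n) rdot (f k.+1) (f k.+1).
Proof.
elim: n => [|n IH]; first by rewrite !big_ord0 addr0 add0r.
rewrite !big_ord_recr /=; have := step_le (lift_state f n) (f n.+1); rewrite -/(lift_output f n).
move: IH; set a := \sum_(_ < _) _; set b := \sum_(_ < _) _; lra.
Qed.

Lemma lift_seq_le (f : K) n :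
  \sum_(k < n) rdot (lift_seq f k) (lift_seq f k) <= rdot f f.
Proof.
apply: (@le_trans _ _ (\sum_(k < n.+1) rdot (lift_seq f k) (lift_seq f k))).
  by rewrite big_ord_recr /= lerDl rdot_ge0.
apply: le_trans (@sdot_partial _ _ _ f n.+1).
(* The initial state [D2 (f 0)] carries exactly the energy that [T2] loses on [f 0]. *)
rewrite 2!big_ord_recl -(TD2 (f 0%N) (f 0%N)) -addrA lerD2l.
by apply: le_trans (lift_state_energy f n); rewrite lerDl rdot_ge0.
Qed.

(** For [z] in the kernel of [D1] the pair [(z, 0)] is orthogonal to every [defect_tgt x], hence to
    the range of [w]. *)
Lemma lift_output_range x y n : orthocompl (defect_constraint D1 n.+1) (w (hpair x y) 0%N).
Proof.
have h z : D1 z = 0 -> rdot z (w (hpair x y) 0%N) = 0.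
  move=> Dz; have := @w_range (hpair x y) (hpair z 0).
  rewrite pair_rdot /= rdot0r addr0 rdotC; apply => x'.
  by rewrite pair_rdot /= rdot0r addr0 D1sym Dz rdot0r.
move=> z /= Dz; apply: inner_eq0; first exact: h.
by rewrite -[X in X *: _]conjcK -rdotZ h // (linZ D1L) Dz scaler0.
Qed.

Lemma lift_seqP (f : K) : lift_seq f \in l2_pred (defect_constraint D1).
Proof.
apply: l2_predP (lift_seq_le f) => -[|n] //; exact: lift_output_range.
Qed.

Definition defect_lift (f : K) : K := L2Seq (lift_seqP f).

Lemma lift_state_lin (c : R[i]) (f g : K) n :
  lift_state (c *: f + g) n = c *: lift_state f n + lift_state g n.
Proof.
elim: n => [|n IH] /=; first exact: D2L.
by rewrite IH hpair_lin wL.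
Qed.

Lemma defect_lift_lin : linear defect_lift.
Proof.
move=> c f g; apply: l2seq_eq => -[|n]; first exact: T2L.
by rewrite [LHS]/= /lift_output lift_state_lin hpair_lin wL.
Qed.

Lemma defect_lift_le f : rnorm (defect_lift f) <= rnorm f.
Proof.
rewrite -(ler_pXn2r (n := 2)) ?nnegrE ?nrm_ge0 // !rnormE.
by apply: sdot_le; exact: lift_seq_le.
Qed.

(** On [V f] the system starts in state [D2 (T1 (f 0))] with first input [D1 (f 0)], which together
    are [defect_src (f 0)]. One step outputs [D1 (T2 (f 0))] and leaves [D2 (f 0)], the initial
    state of the run on [f]; from there the two runs agree with a delay of one, which yields the
    commutation with [V]. *)
Lemma lift_state_shift (f : K) n : lift_state (V f) n.+1 = lift_state f n.
Proof.
elim: n => [|n IH]; last first.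
  by rewrite -[LHS]/(w (hpair (lift_state (V f) n.+1) (V f n.+2)) 1%N) IH.
by rewrite /= -/(defect_src (f 0%N)) w_src.
Qed.

Lemma defect_shift_lift f : V (defect_lift f) = defect_lift (V f).
Proof.
apply: l2seq_eq => -[|[|n]]; first exact: T12.
  by rewrite /= /lift_output /= -/(defect_src (f 0%N)) w_src.
by rewrite [LHS]/= /lift_output -(lift_state_shift f n).
Qed.

(** Here [D2 = 0], so the range of [w] has zero second coordinate and all states vanish. Each input
    lies in the closed range of [D1], so [(0, f n.+1)] lies in the closed range of [defect_src],
    where [w] is isometric. *)
Lemma defect_lift_iso : (forall x, rnorm (T2 x) = rnorm x) ->
  forall f, rnorm (defect_lift f) = rnorm f.
Proof.
move=> T2iso.
have D20 x : D2 x = 0.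
  apply: rdot_eq0; have := TD2 x x; rewrite -!rnormE T2iso; lra.
have w1 x y : w (hpair x y) 1%N = 0.
  apply: rdot_eq0; have := @w_range (hpair x y) (hpair 0 (w (hpair x y) 1%N)).
  rewrite pair_rdot /= rdot0r add0r; apply => x'.
  by rewrite pair_rdot /= rdot0r D20 rdot0l addr0.
have st0 f n : lift_state f n = 0 by case: n => [|n] /=; rewrite ?D20 ?w1.
move=> f; have outE n : rdot (lift_output f n) (lift_output f n) = rdot (f n.+1) (f n.+1).
  have : rnorm (w (hpair 0 (f n.+1))) = rnorm (hpair 0 (f n.+1)).
    apply: w_iso => v hv; rewrite pair_rdot /= rdot0l add0r.
    have Dv : D1 (v 1%N) = 0.
      apply: rdot_inj => z; rewrite rdot0r.
      by have := hv z; rewrite pair_rdot /= D20 rdot0l add0r D1sym.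
    by rewrite rdotC /rdot (@l2_orth _ _ _ f n.+1).
  move=> /(congr1 (fun x => x ^+ 2)); rewrite !rnormE !pair_rdot /= w1.
  by rewrite rdot0l addr0 add0r /lift_output st0.
apply/eqP; rewrite -(eqrXn2 (n := 2)) ?nrm_ge0 // !rnormE; apply/eqP.
rewrite !l2_rdotE; congr (limn (series _)); apply/funext => -[|n].
  by rewrite -!rnormE T2iso.
exact: outE.
Qed.

End CommutantLifting.

(** * Covariance of the shift and of the lifting *)

Section StarEndomorphisms.
Variables (R : realType) (A : cstarAlgType R).

Lemma star_endomorphism_iter (e : A -> A) n :
  star_endomorphism e -> star_endomorphism (iter n e).
Proof.
move=> [eL eM eS]; elim: n => [|n [IL IM IS]]; first by split.
by split=> [c a b|a b|a] /=; rewrite ?IL ?eL ?IM ?eM ?IS ?eS.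
Qed.

Lemma star_representation_comp (H : hilbertType R) (pi : A -> H -> H) (e : A -> A) :
  star_representation pi -> star_endomorphism e ->
  star_representation (fun a => pi (e a)).
Proof.
move=> [piB piL piM piS] [eL eM eS]; split=> [a|c a b h|a b h|a].
- exact: piB.
- by rewrite eL piL.
- by rewrite eM piM.
- by rewrite eS; exact: piS.
Qed.

End StarEndomorphisms.

Section DefectRepresentation.
Variables (R : realType) (A : cstarAlgType R) (H : hilbertType R).
Variables (pi : A -> H -> H) (a1 : A -> A) (T1 D1 : H -> H).
Hypothesis pi_rep : star_representation pi.
Hypothesis a1_endo : star_endomorphism a1.
Hypothesis D1L : linear D1.
Hypothesis D1sym : forall x y, rdot (D1 x) y = rdot x (D1 y).
Hypothesis TD1 : forall x y, rdot (T1 x) (T1 y) + rdot (D1 x) (D1 y) = rdot x y.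
Hypothesis pi_D1 : forall b x, pi (a1 b) (D1 x) = D1 (pi (a1 b) x).
Hypothesis pi_T1 : forall a x, pi a (T1 x) = T1 (pi (a1 a) x).

Local Notation K := (l2seq (defect_constraint D1)).

Lemma rep_rdot a x y : rdot (pi a x) y = rdot x (pi (cstar a) y).
Proof. by have [_ _ _ piS] := pi_rep; rewrite /rdot piS. Qed.

Lemma rep_lin a : linear (pi a).
Proof. by have [piB _ _ _] := pi_rep; have [] := piB a. Qed.

(** Moving one place along the shift costs one application of [a1]. *)
Definition rep_seq (a : A) (f : nat -> H) (n : nat) : H := pi (iter n a1 a) (f n).

(** Composing [pi] with an iterate of [a1] gives a star representation, hence a contractive one: the
    bound [|a|] serves all coordinates. *)
Lemma rep_seq_le a (f : K) n :
  \sum_(k < n) rdot (rep_seq a f k) (rep_seq a f k) <=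
  (complex.Re `|a|) ^+ 2 * rdot f f.
Proof.
apply: (@le_trans _ _ (complex.Re `|a| ^+ 2 * \sum_(k < n) rdot (f k) (f k))).
  rewrite mulr_sumr; apply: ler_sum => k _; rewrite -!rnormE -exprMn.
  rewrite ler_pXn2r ?nnegrE ?mulr_ge0 ?nrm_ge0 //.
  have := star_representation_comp pi_rep (star_endomorphism_iter k a1_endo).
  by move=> /star_representation_contractive; exact.
by rewrite ler_wpM2l ?sqr_ge0 // sdot_partial.
Qed.

(** The kernel of [D1] is invariant under every [pi (a1 b)]; by adjoints its orthogonal complement
    is too. *)
Lemma rep_seqP a (f : K) : rep_seq a f \in l2_pred (defect_constraint D1).
Proof.
have [_ _ _ piS] := pi_rep; have [_ _ a1S] := a1_endo.
apply: l2_predP (rep_seq_le a f) => -[|n] // x /= Dx; rewrite /rep_seq /=.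
have -> : pi (a1 (iter n a1 a)) = pi (cstar (a1 (cstar (iter n a1 a)))).
  by rewrite a1S cstarK.
rewrite -piS; apply: (@l2_orth _ _ _ f n.+1) => /=.
by rewrite -pi_D1 Dx (lin0 (rep_lin _)).
Qed.

Definition defect_rep (a : A) (f : K) : K := L2Seq (rep_seqP a f).

Lemma defect_rep_representation : star_representation defect_rep.
Proof.
have [_ piL piM piS] := pi_rep.
have sL a : linear (defect_rep a).
  by move=> c f g; apply: l2seq_eq => n; exact: rep_lin.
split=> [a|c a b f|a b f|a].
- apply: (@rnorm_bounded_op _ _ _ (complex.Re `|a|)) => // f.
  rewrite -(ler_pXn2r (n := 2)) ?nnegrE ?mulr_ge0 ?nrm_ge0 //.
  by rewrite exprMn !rnormE; apply: sdot_le; exact: rep_seq_le.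
- apply: l2seq_eq => n; rewrite /= /rep_seq.
  by have [iL _ _] := star_endomorphism_iter n a1_endo; rewrite iL piL.
- apply: l2seq_eq => n; rewrite /= /rep_seq.
  by have [_ iM _] := star_endomorphism_iter n a1_endo; rewrite iM piM.
- apply: rdot_adj_inner => // f g.
  rewrite !l2_rdotE; congr (limn (series _)); apply/funext => n /=.
  rewrite /rep_seq rep_rdot.
  by have [_ _ iS] := star_endomorphism_iter n a1_endo; rewrite iS.
Qed.

Lemma defect_rep_shift a f : defect_rep a (defect_shift D1L D1sym TD1 f) =
  defect_shift D1L D1sym TD1 (defect_rep (a1 a) f).
Proof.
apply: l2seq_eq => -[|[|n]] /=; rewrite /rep_seq //=.
by rewrite -iterSr.
Qed.

Lemma defect_rep_embed a h :
  defect_rep a (defect_embed D1 h) = defect_embed D1 (pi a h).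
Proof. by apply: l2seq_eq => -[|n] //; exact: (lin0 (rep_lin _)). Qed.

Section Equivariance.
Variables (a2 : A -> A) (T2 D2 : H -> H).
Hypothesis a2_endo : star_endomorphism a2.
Hypothesis a12 : forall a, a1 (a2 a) = a2 (a1 a).
Hypothesis TD2 : forall x y, rdot (T2 x) (T2 y) + rdot (D2 x) (D2 y) = rdot x y.
Hypothesis pi_D2 : forall b x, pi (a2 b) (D2 x) = D2 (pi (a2 b) x).
Hypothesis pi_T2 : forall a x, pi a (T2 x) = T2 (pi (a2 a) x).

Local Notation H2 := (l2seq (@pair_constraint R H)).
Local Notation src := (defect_src T1 D1 D2).
Local Notation tgt := (defect_tgt D1 T2 D2).

Variable w : H2 -> H2.
Hypothesis w_adj : forall x y, rdot (tgt x) (w y) = rdot (src x) y.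
Hypothesis w_range : forall y v, (forall x, rdot (tgt x) v = 0) -> rdot (w y) v = 0.
Hypothesis w_le : forall y, rnorm (w y) <= rnorm y.

(** The twists are chosen so that [src] and [tgt] both carry [pi (a1 (a2 b))] to the action on
    pairs: moving past [T1] or [T2] supplies the missing [a1] or [a2]. *)
Let src_rep (b : A) (p : H2) : H2 := hpair (pi (a2 b) (p 0%N)) (pi (a1 (a2 b)) (p 1%N)).
Let tgt_rep (b : A) (p : H2) : H2 := hpair (pi (a1 b) (p 0%N)) (pi (a1 (a2 b)) (p 1%N)).

Let src_repP b x : src_rep b (src x) = src (pi (a1 (a2 b)) x).
Proof. by apply: hpair_eq; rewrite /= ?pi_D2 ?pi_T1 ?pi_D1. Qed.

Let tgt_repP b x : tgt_rep b (tgt x) = tgt (pi (a1 (a2 b)) x).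
Proof.
by apply: hpair_eq; rewrite /= ?pi_D1 ?pi_T2 a12 // pi_D2.
Qed.

Let src_rep_adj b p q : rdot (src_rep b p) q = rdot p (src_rep (cstar b) q).
Proof.
have [_ _ s1] := a1_endo; have [_ _ s2] := a2_endo.
by rewrite !pair_rdot /= !rep_rdot !s2 !s1.
Qed.

Let tgt_rep_adj b p q : rdot (tgt_rep b p) q = rdot p (tgt_rep (cstar b) q).
Proof.
have [_ _ s1] := a1_endo; have [_ _ s2] := a2_endo.
by rewrite !pair_rdot /= !rep_rdot !s2 !s1.
Qed.

(** Both sides lie in the closed range of [tgt], which [tgt_rep] preserves because its adjoint is
    [tgt_rep (cstar b)]; so it suffices to pair with [tgt x] and move everything to [src x]. *)
Lemma transfer_equivariant b p : w (src_rep b p) = tgt_rep b (w p).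
Proof.
apply: (range_uniq (Q := tgt)) => [v /w_range //|v vQ|x].
  rewrite tgt_rep_adj; apply: w_range => x.
  by rewrite -[b]cstarK -tgt_rep_adj cstarK tgt_repP vQ.
rewrite w_adj -[b]cstarK -src_rep_adj src_repP -w_adj -tgt_repP.
by rewrite tgt_rep_adj.
Qed.

Let iter12 n a : iter n a1 (a2 a) = a2 (iter n a1 a).
Proof. by elim: n => //= n ->; rewrite a12. Qed.

(** At time [n] the state transforms under [pi (a2 (iter n a1 a))] and the input [f n.+1] under one
    more [a1]: exactly [src_rep] at [iter n a1 a]. *)
Lemma lift_state_equivariant a (f : K) n :
  lift_state D2 w (defect_rep (a2 a) f) n = pi (a2 (iter n a1 a)) (lift_state D2 w f n).
Proof.
elim: n => [|n IH]; first by rewrite /= /rep_seq /= pi_D2.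
rewrite [LHS]/= IH /rep_seq /= iter12.
have := transfer_equivariant (iter n a1 a) (hpair (lift_state D2 w f n) (f n.+1)).
by move=> /(congr1 (fun p : H2 => p 1%N)) /= ->; rewrite a12.
Qed.

Lemma defect_rep_lift a f :
  defect_rep a (defect_lift D1L D1sym TD2 w_range w_le f) =
  defect_lift D1L D1sym TD2 w_range w_le (defect_rep (a2 a) f).
Proof.
apply: l2seq_eq => -[|n] /=; first exact: pi_T2.
rewrite /lift_output lift_state_equivariant /= /rep_seq /= iter12.
have := transfer_equivariant (iter n a1 a) (hpair (lift_state D2 w f n) (f n.+1)).
by move=> /(congr1 (fun p : H2 => p 0%N)) /= ->.
Qed.

End Equivariance.

End DefectRepresentation.

Section OneStep.
Variables (R : realType) (A : cstarAlgType R).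

(** This is [V^* J = J T^*], tested against vectors so that no adjoint of [V] has to be chosen. *)
Definition coextending (H K : hilbertType R) (J : H -> K) (T : H -> H) (V : K -> K) :=
  forall T' : H -> H, (forall x y, rdot (T x) y = rdot x (T' y)) ->
  forall k h, rdot (V k) (J h) = rdot k (J (T' h)).

(** [T^* T] commutes with [pi (a b)]: covariance at [b] gives [T^* T pi (a b) = T^* pi b T], and the
    adjoint of covariance at [b^*] turns [T^* pi b] into [pi (a b) T^*]. *)
Lemma defect_operator (H : hilbertType R) (pi : A -> H -> H) (a : A -> A) (T : H -> H) :
  star_representation pi -> star_endomorphism a -> linear T ->
  (forall x, rnorm (T x) <= rnorm x) ->
  (forall b x, pi b (T x) = T (pi (a b) x)) ->
  exists D : H -> H,
  [/\ linear D, forall x y, rdot (D x) y = rdot x (D y),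
      forall x y, rdot (T x) (T y) + rdot (D x) (D y) = rdot x y &
      forall b x, pi (a b) (D x) = D (pi (a b) x)].
Proof.
move=> pir ae TL Tc piT.
have [|T' [T'L adj T'c]] := exists_adjoint TL (@ler01 R).
  by move=> x; rewrite mul1r.
have [|x|x y|D [DL Dsym DD Dcomm]] := @operator_root R H (fun x => T' (T x)).
- by move=> c x y; rewrite TL T'L.
- by have := T'c (T x); rewrite mul1r => /le_trans; apply.
- by rewrite rdotC -adj rdotC adj.
exists D; split=> // [x y|b x].
  by rewrite Dsym DD rdotBr adj addrC subrK.
apply: (Dcomm (pi (a b)) (complex.Re `|a b|)); first exact: (rep_lin pir).
  exact: star_representation_contractive.
have [_ _ as_] := ae.
move=> {}x; apply: rdot_inj => z.
rewrite -[RHS]adj -piT rdotC (rep_rdot pir) rdotC -as_ -adj -piT.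
by rewrite (rep_rdot pir) cstarK.
Qed.

(** The last two clauses serve the iteration: the fourth keeps an isometry isometric in the second
    round, the fifth transports an identity [pi (e a) = pi a] and is used with [e = alpha 0]. *)
Lemma one_step (H : hilbertType R) (pi : A -> H -> H) (a1 a2 : A -> A) (T1 T2 : H -> H) :
  star_representation pi -> star_endomorphism a1 -> star_endomorphism a2 ->
  (forall a, a1 (a2 a) = a2 (a1 a)) -> linear T1 -> linear T2 ->
  (forall x, T1 (T2 x) = T2 (T1 x)) ->
  (forall x, rnorm (T1 x) <= rnorm x) -> (forall x, rnorm (T2 x) <= rnorm x) ->
  (forall a x, pi a (T1 x) = T1 (pi (a1 a) x)) ->
  (forall a x, pi a (T2 x) = T2 (pi (a2 a) x)) ->
  exists (K : hilbertType R) (sig : A -> K -> K) (V S : K -> K) (J : H -> K),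
  [/\ [/\ star_representation sig, forall a x, sig a (V x) = V (sig (a1 a) x) &
         forall a x, sig a (S x) = S (sig (a2 a) x)],
     [/\ linear V, linear S, forall x, V (S x) = S (V x),
         forall x, rnorm (V x) = rnorm x & forall x, rnorm (S x) <= rnorm x],
     [/\ linear J, forall x y, rdot (J x) (J y) = rdot x y,
         forall a x, sig a (J x) = J (pi a x),
         coextending J T1 V & coextending J T2 S],
     (forall x, rnorm (T2 x) = rnorm x) -> forall x, rnorm (S x) = rnorm x &
     forall e : A -> A, (forall a x, pi (e a) x = pi a x) ->
       (forall a, e (a1 a) = a1 (e a)) -> forall a x, sig (e a) x = sig a x].
Proof.
move=> pir e1 e2 a12 T1L T2L T12 T1c T2c piT1 piT2.
have [D1 [D1L D1sym TD1 piD1]] := defect_operator pir e1 T1L T1c piT1.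
have [D2 [D2L D2sym TD2 piD2]] := defect_operator pir e2 T2L T2c piT2.
have [w [[wL wsrc] wadj wrange wle wiso]] := partial_isometry
  (defect_src_lin T1L D1L D2L) (defect_tgt_lin D1L T2L D2L)
  (defect_src_tgt TD1 TD2 T12).
pose K := l2seq (defect_constraint D1).
exists K, (defect_rep pir e1 piD1), (defect_shift D1L D1sym TD1),
  (defect_lift D1L D1sym TD2 wrange wle), (defect_embed D1).
split.
- split; first exact: defect_rep_representation.
    exact: defect_rep_shift.
  exact: defect_rep_lift.
- split.
  + exact: defect_shift_lin.
  + exact: defect_lift_lin.
  + exact: defect_shift_lift.
  + exact: defect_shift_iso.
  + exact: defect_lift_le.
- split.
  + exact: defect_embed_lin.
  + by move=> x y; rewrite rdot_defect_embed.
  + exact: defect_rep_embed.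
  + by move=> T' adj f h; rewrite !rdot_defect_embed adj.
  + by move=> T' adj f h; rewrite !rdot_defect_embed adj.
- by move=> T2iso; apply: (defect_lift_iso (T1 := T1)) => //; exact: wiso.
- move=> e pe ea a f; apply: l2seq_eq => n; rewrite /= /rep_seq.
  have -> : iter n a1 (e a) = e (iter n a1 a) by elim: n => //= n ->.
  exact: pe.
Qed.

End OneStep.

Section IterLemmas.

Lemma iter_comm (X : Type) (f g : X -> X) n :
  (forall x, f (g x) = g (f x)) -> forall x, iter n f (g x) = g (iter n f x).
Proof. by move=> fg x; elim: n => //= n ->. Qed.

Lemma iter_iter_comm (X : Type) (f g : X -> X) m n :
  (forall x, f (g x) = g (f x)) ->
  forall x, iter m f (iter n g x) = iter n g (iter m f x).
Proof.
move=> fg x; apply: (iter_comm m) => {}x.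
by apply/esym; apply: (iter_comm n) => {}x; rewrite fg.
Qed.

Lemma iter_linear (K : pzRingType) (U : lmodType K) (S : U -> U) n :
  linear S -> linear (iter n S).
Proof. by move=> SL; elim: n => // n IH c x y; rewrite !iterS IH SL. Qed.

Lemma iter_adj (R : realType) (H : hilbertType R) (S S' : H -> H) n :
  (forall x y, rdot (S x) y = rdot x (S' y)) ->
  forall x y, rdot (iter n S x) y = rdot x (iter n S' y).
Proof.
by move=> adj x y; elim: n x y => //= n IH x y; rewrite adj IH -iterSr.
Qed.

Lemma iter_intertwine (X Y : Type) (J : X -> Y) (f : X -> X) (g : Y -> Y) n :
  (forall x, g (J x) = J (f x)) -> forall x, iter n g (J x) = J (iter n f x).
Proof. by move=> gJ x; elim: n => //= n ->; rewrite gJ. Qed.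

End IterLemmas.

(** * The two-parameter dilation *)

Section Dilation.
Variables (R : realType) (A : cstarAlgType R) (alpha : cstar_dyn A).

(** The innermost [alpha 0] stays: it is the value at the origin and may differ from the
    identity. *)
Lemma dyn_actE m n a : alpha (m, n) a =
  iter n (alpha (0, 1)%N) (iter m (alpha (1, 0)%N) (alpha 0 a)).
Proof.
elim: n => [|n IH].
  elim: m => [//|m IH] /=.
  have -> : (m.+1, 0%N) = ((1, 0)%N + (m, 0)%N)%R by [].
  by rewrite dyn_actD IH.
have -> : (m, n.+1) = ((0, 1)%N + (m, n))%R by [].
by rewrite dyn_actD IH.
Qed.

Lemma semigroup_repE (H : hilbertType R) (T : nat * nat -> H -> H) : semigroup_rep T ->
  forall m n x, T (m, n) x = iter m (T (1, 0)%N) (iter n (T (0, 1)%N) x).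
Proof.
move=> [_ T0 TD] m n x; elim: m => [|m IH].
  elim: n => [|n IH] /=; first exact: T0.
  have -> : (0%N, n.+1) = ((0, 1)%N + (0%N, n))%R by [].
  by rewrite TD IH.
have -> : (m.+1, n) = ((1, 0)%N + (m, n))%R by [].
by rewrite TD IH.
Qed.

Lemma coextending_comp (H K L : hilbertType R) (J : H -> K) (J' : K -> L) T V W :
  linear V -> (forall x, rnorm (V x) <= rnorm x) ->
  coextending J T V -> coextending J' V W -> coextending (J' \o J) T W.
Proof.
move=> VL Vc JT JV T' adj k h.
have [|V' [_ Vadj _]] := exists_adjoint VL (@ler01 R).
  by move=> x; rewrite mul1r.
rewrite /= (JV V' Vadj); congr (rdot k (J' _)).
by apply: rdot_inj => z; rewrite -Vadj (JT T' adj).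
Qed.

Theorem isometric_coextension (p : covpair alpha) : contractive p ->
  exists q : covpair alpha, isometric q /\ coextends q p.
Proof.
case: p => H pi T pir Tr cov /= pc.
pose a1 := alpha (1, 0)%N; pose a2 := alpha (0, 1)%N; pose e := alpha 0.
have [TB T0 TD] := Tr.
have aC s t a : alpha s (alpha t a) = alpha t (alpha s a).
  by rewrite -!dyn_actD addrC.
have Tc s x : rnorm (T s x) <= rnorm x by have := pc s x; rewrite nrm_le.
have TL s : linear (T s) by have [] := TB s.
have TC s t x : T s (T t x) = T t (T s x) by rewrite -!TD addrC.
(* Covariance at [0], where [T] is the identity. *)
have pe a x : pi (e a) x = pi a x by have := cov a 0 x; rewrite !T0.
have [K1 [sig1 [V1 [S1 [J1 [[r1 V1cov S1cov]
    [V1L S1L VS1 V1i S1c] [J1L J1i J1p J1V J1S] _ E1]]]]]] :=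
  one_step pir (dyn_endo alpha (1, 0)%N) (dyn_endo alpha (0, 1)%N) (aC _ _)
    (TL _) (TL _) (TC _ _) (Tc _) (Tc _)
    (fun a => cov a (1, 0)%N) (fun a => cov a (0, 1)%N).
(* The second round exchanges the roles: [W2] dilates [S1], and [W1] lifts the isometry [V1]. *)
have V1c x : rnorm (V1 x) <= rnorm x by rewrite V1i.
have [K [sig [W2 [W1 [J2 [[r2 W2cov W1cov]
    [W2L W1L WW W2i W1c] [J2L J2i J2p J2S J2V] W1i E2]]]]]] :=
  one_step r1 (dyn_endo alpha (0, 1)%N) (dyn_endo alpha (1, 0)%N) (aC _ _)
    S1L V1L (fun x => esym (VS1 x)) S1c V1c S1cov V1cov.
have {}W1i := W1i V1i.
have sige a x : sig (e a) x = sig a x.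
  by apply: E2 => [b y|b]; [apply: E1 => [|b']; [exact: pe|exact: aC]|exact: aC].
pose J := J2 \o J1.
have Jco1 : coextending J (T (1, 0)%N) W1 by exact: coextending_comp J1V J2V.
have Jco2 : coextending J (T (0, 1)%N) W2 by exact: coextending_comp J1S J2S.
pose W (s : nat * nat) (x : K) : K := iter s.1 W1 (iter s.2 W2 x).
have WC x : W1 (W2 x) = W2 (W1 x) by rewrite WW.
have WL s : linear (W s).
  by move=> c x y; rewrite /W (iter_linear _ W2L) (iter_linear _ W1L).
have Wi s x : rnorm (W s x) = rnorm x.
  rewrite /W; elim: s.1 => [|m IH] /=; last by rewrite W1i.
  by elim: s.2 => [|n IH] //=; rewrite W2i.
have Wr : semigroup_rep W.
  split=> [s|//|s t x].
    by apply: (@rnorm_bounded_op _ _ _ 1) => // x; rewrite mul1r Wi.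
  rewrite /W /= iterD; congr (iter _ _ _).
  by rewrite iterD (iter_iter_comm _ _ WC).
have sigW a s x : sig a (W s x) = W s (sig (alpha s a) x).
  case: s => m n; rewrite dyn_actE -/a1 -/a2 -/e /W /=.
  have h1 k b y : sig b (iter k W1 y) = iter k W1 (sig (iter k a1 b) y).
    by elim: k b => // k IH b; rewrite [LHS]W1cov IH -iterSr.
  have h2 k b y : sig b (iter k W2 y) = iter k W2 (sig (iter k a2 b) y).
    by elim: k b => // k IH b; rewrite [LHS]W2cov IH -iterSr.
  rewrite h1 h2; congr (iter _ _ (iter _ _ _)).
  rewrite -(sige (iter n a2 _)); congr (sig _ x).
  rewrite (iter_comm m (f := a1) (g := e)) => [|b]; last exact: aC.
  by rewrite (iter_comm n (f := a2) (g := e)) // => b; exact: aC.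
pose q := @CovPair R A alpha K sig W r2 Wr sigW.
exists q; split; first by move=> s x; rewrite norm_realE [RHS]norm_realE; congr (_%:C); exact: Wi.
have JL : linear J by move=> c x y; rewrite /J /= J1L J2L.
have Ji x y : rdot (J x) (J y) = rdot x y by rewrite /J /= J2i J1i.
have Jp a x : sig a (J x) = J (pi a x) by rewrite /J /= J2p J1p.
exists J; split=> //.
- move=> x y; apply: eq_inner_rdot; first exact: Ji.
  by rewrite -(linZ JL) Ji.
- move=> a; split; last by move=> h; exact: Jp.
  split=> [_ [_ [h _ <-] <-]|_ [y yJ <-] _ [h _ <-]].
    by exists (pi a h) => //; rewrite /= Jp.
  (* Invariance under all of [sig] suffices: [sig a] moves across the inner product as
     [sig (cstar a)]. *)
  have [_ _ _ sigS] := r2.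
  by rewrite /= -[a]cstarK -sigS Jp yJ //; exists (pi (cstar a) h).
- case=> m n.
  have [|T1' [_ T1a _]] := exists_adjoint (TL (1, 0)%N) (@ler01 R).
    by move=> x; rewrite mul1r.
  have [|T2' [_ T2a _]] := exists_adjoint (TL (0, 1)%N) (@ler01 R).
    by move=> x; rewrite mul1r.
  have [|W1' [_ W1a _]] := exists_adjoint W1L (@ler01 R).
    by move=> x; rewrite mul1r.
  have [|W2' [_ W2a _]] := exists_adjoint W2L (@ler01 R).
    by move=> x; rewrite mul1r W2i.
  have W1J h : W1' (J h) = J (T1' h).
    by apply: rdot_inj => z; rewrite -W1a (Jco1 T1').
  have W2J h : W2' (J h) = J (T2' h).
    by apply: rdot_inj => z; rewrite -W2a (Jco2 T2').
  exists (fun y => iter n W2' (iter m W1' y)), (fun y => iter n T2' (iter m T1' y)).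
  split.
  + apply: rdot_adj_inner; first exact: WL.
    by move=> x y; rewrite /= /W /= (iter_adj _ W1a) (iter_adj _ W2a).
  + apply: rdot_adj_inner; first exact: TL.
    by move=> x y; rewrite /= (semigroup_repE Tr) (iter_adj _ T1a) (iter_adj _ T2a).
  + by move=> h; rewrite (iter_intertwine _ W1J) (iter_intertwine _ W2J).
Qed.

End Dilation.

(** * Semicrossed products *)

Section MatrixNorms.
Variable R : realType.

Lemma l2norm_le (H K : hilbertType R) n (x : 'I_n -> H) (y : 'I_n -> K) :
  (forall i, rnorm (x i) <= rnorm (y i)) -> l2norm x <= l2norm y.
Proof.
move=> xy; apply: ler_wsqrtr; apply: ler_sum => i _.
by rewrite ler_pXn2r ?nnegrE ?nrm_ge0.
Qed.

(** Entrywise [F = J^* G J]. For a row sum, [|u|^2 = rdot v (J u) <= |v| |u|], and [J] acting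
    diagonally preserves the norm of the argument. *)
Lemma mx_opnorm_compression (H K : hilbertType R) (J : H -> K) n
    (F : 'I_n -> 'I_n -> H -> H) (G : 'I_n -> 'I_n -> K -> K) :
  (forall x y, rdot (J x) (J y) = rdot x y) ->
  (forall i j h y, rdot (F i j h) y = rdot (G i j (J h)) (J y)) ->
  (mx_opnorm F <= mx_opnorm G)%E.
Proof.
move=> Ji FG.
have Jn x : rnorm (J x) = rnorm x.
  by apply/eqP; rewrite -(eqrXn2 (n := 2)) ?nrm_ge0 // !rnormE Ji.
apply: ge_ereal_sup => _ [x x1 <-].
apply: (@le_trans _ _ (l2norm (fun i => \sum_(j < n) G i j (J (x j))))%:E); last first.
  apply: ereal_sup_ubound; exists (fun j => J (x j)) => //=.
  by apply: le_trans x1; apply: l2norm_le => i; rewrite Jn.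
rewrite lee_fin; apply: l2norm_le => i.
set u := \sum_(j < n) F i j (x j); set v := \sum_(j < n) G i j (J (x j)).
have uv y : rdot u y = rdot v (J y).
  rewrite /u /v (big_morph (fun z => rdot z y) (fun a b => rdotDl a b y) (rdot0l y)).
  rewrite (big_morph (fun z => rdot z (J y)) (fun a b => rdotDl a b (J y)) (rdot0l _)).
  by apply: eq_bigr => j _; exact: FG.
have h : rnorm u * rnorm u <= rnorm v * rnorm u.
  by rewrite -expr2 rnormE uv -[X in _ <= _ * X]Jn rdot_le.
have [u0|u0] := eqVneq (rnorm u) 0; first by rewrite u0 nrm_ge0.
by rewrite ler_pM2r // in h; rewrite lt_neqAle eq_sym u0 nrm_ge0.
Qed.

Lemma l2norm1 (H : hilbertType R) (x : 'I_1 -> H) : l2norm x = rnorm (x ord0).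
Proof. by rewrite /l2norm big_ord1 sqrtr_sqr ger0_norm // nrm_ge0. Qed.

Lemma mx_opnorm1_le (H : hilbertType R) (S : H -> H) (e : R) : linear S ->
  (mx_opnorm (fun _ _ : 'I_1 => S) <= e%:E)%E -> forall h, rnorm (S h) <= e * rnorm h.
Proof.
move=> SL Se h; have [h0|h0] := eqVneq (rnorm h) 0.
  by rewrite h0 mulr0 (nrm_eq0 h0) (lin0 SL) /rnorm normr0.
have hp : 0 < rnorm h by rewrite lt_neqAle eq_sym h0 nrm_ge0.
pose x (_ : 'I_1) := (rnorm h)^-1%:C *: h.
have xn : l2norm x = 1.
  by rewrite l2norm1 /x /rnorm nrmZ ger0_norm ?invr_ge0 ?nrm_ge0 // mulVf.
have : ((l2norm (fun i : 'I_1 => \sum_(j < 1) S (x j)))%:E <= e%:E)%E.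
  by apply: le_trans Se; apply: ereal_sup_ubound; exists x => //=; rewrite xn.
rewrite lee_fin l2norm1 big_ord1 /x (linZ SL) /rnorm nrmZ.
by rewrite ger0_norm ?invr_ge0 ?nrm_ge0 // mulrC ler_pdivrMr.
Qed.

End MatrixNorms.

Section CompletelyIsometric.
Variables (R : realType) (A : cstarAlgType R) (alpha : cstar_dyn A).
Implicit Types C : covpair alpha -> Prop.

Definition compresses (p q : covpair alpha) (J : cp_space p -> cp_space q) :=
  [/\ linear J, forall x y, rdot (J x) (J y) = rdot x y &
      forall (f : c00 A) h y,
        rdot (integrated f h) y = rdot (integrated f (J h)) (J y)].

(** Termwise [rdot (V_s sigma_a J h) (J y) = rdot (J pi_a h) (J T_s^* y)], since [J] intertwines the
    representations and [V_s^* J = J T_s^*]. *)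
Lemma coextends_compresses (p q : covpair alpha) : coextends q p ->
  exists J : cp_space p -> cp_space q, compresses J.
Proof.
move=> [J [JL Ji Jp JT]]; exists J.
have Jr x y : rdot (J x) (J y) = rdot x y by rewrite /rdot Ji.
split=> // f h y; rewrite /integrated.
rewrite (big_morph (fun z => rdot z y) (fun a b => rdotDl a b y) (rdot0l y)).
rewrite (big_morph (fun z => rdot z (J y)) (fun a b => rdotDl a b (J y)) (rdot0l _)).
apply: eq_bigr => s _; have [Vs [Ts [Va Ta VT]]] := JT s.
have [_ ->] := Jp (f s).
by rewrite [RHS]/rdot Va VT -/(rdot _ _) Jr /rdot Ta.
Qed.

Lemma integrated_lin (p : covpair alpha) (f : c00 A) : linear (@integrated R A alpha p f).
Proof.
move=> c x y; rewrite /integrated scaler_sumr -big_split; apply: eq_bigr => s _ /=.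
have [piB _ _ _] := cp_piP p; have [TB _ _] := cp_TP p.
by have [piL _] := piB (f s); have [TL _] := TB s; rewrite piL TL.
Qed.

Lemma fam_mxnorm_approx C (F : opfamily C) (f : c00 A) (e : R) :
  (forall p, bounded_op (F p)) ->
  (fam_mxnorm (fun _ _ : 'I_1 => fam_lin (-1)%R (canonical_map C f) F) < e%:E)%E ->
  forall p h, rnorm (F p h - integrated f h) <= e * rnorm h.
Proof.
move=> FB Fe p h.
have e1 : F p h - integrated f h = (fam_lin (-1) (canonical_map C f) F : opfamily C) p h.
  by rewrite /fam_lin /canonical_map scaleN1r addrC.
rewrite e1; apply: mx_opnorm1_le => [c x y|].
  have [FL _] := FB p.
  rewrite /fam_lin /canonical_map integrated_lin FL !scaleN1r.
  by rewrite opprD scalerDr scalerN addrACA.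
apply: le_trans (ltW Fe); apply: ereal_sup_ubound.
by exists p.
Qed.

(** The identity holds for integrated forms. One [f] approximates [F] at [p] and at [q]
    simultaneously, so it passes to the closure. *)
Lemma semicrossed_compression C (F : opfamily C) (p q : covpair alpha) (Cp : C p) (Cq : C q)
    (J : cp_space p -> cp_space q) :
  semicrossed_product F -> compresses J ->
  forall h y, rdot (F (exist _ p Cp) h) y = rdot (F (exist _ q Cq) (J h)) (J y).
Proof.
move=> [FB Fa] [JL Ji Jf] h y.
set P := exist _ p Cp; set Q := exist _ q Cq.
have Jn x : rnorm (J x) = rnorm x.
  by apply/eqP; rewrite -(eqrXn2 (n := 2)) ?nrm_ge0 // !rnormE Ji.
apply/eqP; rewrite -subr_eq0 -normr_le0.
apply/ler_addgt0Pl => e e0; rewrite addr0.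
(* Two errors of size at most [d |h| |y|]; the 1 covers [|h| |y| = 0]. *)
pose d := e / (2 * (rnorm h * rnorm y) + 1).
have hy0 : 0 <= rnorm h * rnorm y by rewrite mulr_ge0 ?nrm_ge0.
have d0 : 0 < d by rewrite divr_gt0 //; lra.
have [f fd] := Fa d d0; have fa := fam_mxnorm_approx FB fd.
have -> : rdot (F P h) y - rdot (F Q (J h)) (J y) =
  rdot (F P h - integrated f h) y - rdot (F Q (J h) - integrated f (J h)) (J y).
  rewrite !rdotBl; have := Jf f h y; rewrite [X in X -> _]/=.
  by move=> ->; ring.
apply: le_trans (ler_normB _ _) _.
apply: le_trans (lerD (rdot_cauchy_schwarz _ _) (rdot_cauchy_schwarz _ _)) _.
have k1 := fa P h; have k2 := fa Q (J h); rewrite Jn in k2.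
rewrite Jn; apply: (@le_trans _ _ (d * rnorm h * rnorm y + d * rnorm h * rnorm y)).
  by apply: lerD; rewrite ler_wpM2r ?nrm_ge0.
have -> : d * rnorm h * rnorm y + d * rnorm h * rnorm y =
  d * (2 * (rnorm h * rnorm y)) by ring.
rewrite /d mulrAC ler_pdivrMr; last by lra.
by rewrite ler_pM2l //; lra.
Qed.

Lemma isometric_contractive (p : covpair alpha) : isometric p -> contractive p.
Proof. by move=> pi s h; rewrite pi. Qed.

Let C := @contractive R A alpha.
Let D := @isometric R A alpha.

Definition restrict_family (F : opfamily C) : opfamily D :=
  fun p => F (exist _ (sval p) (isometric_contractive (proj2_sig p))).

Lemma restrict_mxnorm_le n (F : 'I_n -> 'I_n -> opfamily C) :
  (fam_mxnorm (fun i j => restrict_family (F i j)) <= fam_mxnorm F)%E.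
Proof.
apply: ge_ereal_sup => _ [p ->]; apply: ereal_sup_ubound.
by exists (exist _ (sval p) (isometric_contractive (proj2_sig p))).
Qed.

Lemma restrict_semicrossed F : semicrossed_product F ->
  semicrossed_product (restrict_family F).
Proof.
move=> [FB Fa]; split=> [p|e e0].
  exact: (FB (exist _ (sval p) (isometric_contractive (proj2_sig p)))).
have [f fe] := Fa e e0; exists f; apply: le_lt_trans fe.
exact: (restrict_mxnorm_le (fun _ _ => fam_lin (-1) (canonical_map C f) F)).
Qed.

Lemma isometric_compression (p : {p | C p}) : exists (q : {q | D q})
  (J : cp_space (sval p) -> cp_space (sval q)), compresses J.
Proof.
case: p => p Cp /=; have [q [Dq qp]] := isometric_coextension Cp.
by exists (exist _ q Dq); exact: coextends_compresses.
Qed.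

Lemma restrict_mxnorm n (F : 'I_n -> 'I_n -> opfamily C) :
  (forall i j, semicrossed_product (F i j)) ->
  fam_mxnorm (fun i j => restrict_family (F i j)) = fam_mxnorm F.
Proof.
move=> FS; apply/eqP; rewrite eq_le restrict_mxnorm_le /=.
apply: ge_ereal_sup => _ [p ->].
have [[q Dq] [J Jc]] := isometric_compression p.
apply: (@le_trans _ _ (mx_opnorm (fun i j =>
  (restrict_family (F i j) : opfamily D) (exist _ q Dq)))); last first.
  by apply: ereal_sup_ubound; exists (exist _ q Dq).
case: p J Jc => p Cp J Jc.
apply: (mx_opnorm_compression (J := J)); first by case: Jc.
by move=> i j h y; exact: semicrossed_compression.
Qed.

Lemma restrict_inj F F' : semicrossed_product F -> semicrossed_product F' ->
  restrict_family F = restrict_family F' -> F = F'.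
Proof.
move=> FS FS' FF'; apply: functional_extensionality_dep => p; apply/funext => h.
have [[q Dq] [J Jc]] := isometric_compression p; case: p h J Jc => p Cp h J Jc.
apply: rdot_inj => y; rewrite rdotC [RHS]rdotC.
rewrite (semicrossed_compression (Cp := Cp) (isometric_contractive Dq) FS Jc).
rewrite (semicrossed_compression (Cp := Cp) (isometric_contractive Dq) FS' Jc).
congr (rdot _ (J y)).
exact: (congr1 (fun G : opfamily D => G (exist _ q Dq) (J h)) FF').
Qed.

(** [F p] is [J^* (G q) J] for a chosen [q]. An [f] close to [G] is as close to [F], since the
    difference is compressed as well. At an isometric [p], [G] itself satisfies the compression
    identity between [p] and [q], so [F p = G p] whatever the choice. *)
Lemma restrict_surj G : semicrossed_product G ->
  exists2 F, semicrossed_product F & restrict_family F = G.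
Proof.
move=> GS; have [GB Ga] := GS.
have ex (p : {p | C p}) : exists Fp : cp_space (sval p) -> cp_space (sval p),
    exists (q : {q | D q}) (J : cp_space (sval p) -> cp_space (sval q)),
    [/\ compresses J, bounded_op Fp & forall h y, rdot (Fp h) y = rdot (G q (J h)) (J y)].
  have [q [J Jc]] := isometric_compression p; have [JL Ji _] := Jc.
  have Jn x : rnorm (J x) = rnorm x.
    by apply/eqP; rewrite -(eqrXn2 (n := 2)) ?nrm_ge0 // !rnormE Ji.
  have [|J' [J'L Ja J'n]] := exists_adjoint JL (@ler01 R).
    by move=> x; rewrite mul1r Jn.
  exists (fun h => J' (G q (J h))), q, J; split=> //.
    have [GL [M M0 GM]] := bounded_opP (GB q).
    apply: (@rnorm_bounded_op _ _ _ M) => [c x y|x].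
      by rewrite JL GL J'L.
    by apply: le_trans (J'n _) _; rewrite mul1r -(Jn x) GM.
  by move=> h y; rewrite rdotC -Ja rdotC.
pose F : opfamily C := fun p => sval (cid (ex p)).
have FP p := svalP (cid (ex p)).
have FS : semicrossed_product F.
  split=> [p|e e0]; first by have [q [J []]] := FP p.
  have [f fe] := Ga e e0; exists f; apply: le_lt_trans fe.
  apply: ge_ereal_sup => _ [p ->].
  have [q [J [[JL Ji Jf] _ FJ]]] := FP p.
  apply: (@le_trans _ _ (mx_opnorm (fun _ _ : 'I_1 =>
    (fam_lin (-1) (canonical_map D f) G : opfamily D) q))).
    apply: (mx_opnorm_compression (J := J)) => // _ _ h y.
    rewrite /fam_lin /canonical_map !scaleN1r !rdotDl !rdotNl -Jf; congr (_ + _).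
    exact: FJ.
  by apply: ereal_sup_ubound; exists q.
exists F => //.
apply: functional_extensionality_dep => -[p Dp]; apply/funext => h.
apply: rdot_inj => y; rewrite rdotC [RHS]rdotC.
have [[q Dq] [J [Jc _ FJ]]] := FP (exist _ p (isometric_contractive Dp)).
by rewrite [LHS]FJ (semicrossed_compression (Cp := Dp) Dq GS Jc).
Qed.

End CompletelyIsometric.

Theorem theorem3p4p2 (R : realType) (A : cstarAlgType R) (alpha : cstar_dyn A) :
  (forall p : covpair alpha, contractive p ->
     exists q : covpair alpha, isometric q /\ coextends q p) /\
  canonically_completely_isometric (@contractive R A alpha)
    (@isometric R A alpha).
Proof.
split=> [p|]; first exact: isometric_coextension.
(* Restriction acts pointwise, so compatibility with the operations and the canonical maps is
   definitional. *)
exists (@restrict_family R A alpha); split=> //.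
- exact: restrict_semicrossed.
- move=> G GS; have [F FS FG] := restrict_surj GS.
  exists F; split=> // F' [FS' FG']; apply: restrict_inj => //.
  by rewrite FG FG'.
- exact: restrict_mxnorm.
Qed.
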